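(* Assume that the kernels satisfy $0\le k^j(x,x')\le K^j$ for all $x,x'\in\mathbb X^j$ and $j\in[d]$. For any $\alpha\in(0,1)$, $\beta\in(0,1-\alpha)$, $\epsilon>0$, $\delta\in[0,1)$ and $B\ge6\alpha^{-1}\log(2\beta^{-1})$, the minimum separation of $\phi_{\mathrm{dpdHSIC}}$ satisfies $$\rho_{\phi_{\mathrm{dpdHSIC}}}(\alpha,\beta,\epsilon,\delta,n)\le C_K\max\Big\{\sqrt{\frac{\max\{\log(1/\alpha),\log(1/\beta)\}}{n}},\ \frac{\max\{\log(1/\alpha),\log(1/\beta)\}}{n\,\xi_{\epsilon,\delta}}\Big\},$$ where $C_K$ is a positive constant that only depends on $K^j$ for $j\in[d]$.
   Context: Superscripts $j\in[d]=\{1,\dots,d\}$ are indices, not exponents; $d\ge2$ is fixed. For each $j$, $\mathbb X^j$ is a separable topological space and $k^j:\mathbb X^j\times\mathbb X^j\to\mathbb R$ is a continuous, bounded, positive semi-definite kernel with RKHS $\mathcal H^j$. The tensor product kernel $\mathbf k((x^j)_j,(x'^j)_j)=\prod_{j}k^j(x^j,x'^j)$, with RKHS $\mathcal H_{\mathbf k}=\mathcal H^1\otimes\dots\otimes\mathcal H^d$ and unit ball $\mathcal F_{\mathbf k}$, is assumed characteristic. $K_0=\prod_{j}K^j$. For a distribution $P=P_{X^1,\dots,X^d}$ on $\mathbb X^1\times\dots\times\mathbb X^d$ with marginals $P_{X^j}$, $$\mathrm{dHSIC}_{\mathbf k}(P)=\sup_{f\in\mathcal F_{\mathbf k}}\{\mathbb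 E_{P}[f(X^1,\dots,X^d)]-\mathbb E_{\otimes_jP_{X^j}}[f(X^1,\dots,X^d)]\}.$$ For an i.i.d. sample $\mathcal X_n=(\mathbf X_1,\dots,\mathbf X_n)$ from $P$, $\mathbf X_i=(X_i^1,\dots,X_i^d)$, $$\widehat{\mathrm{dHSIC}}(\mathcal X_n)=\sup_{f\in\mathcal F_{\mathbf k}}\Big\{\frac1n\sum_{i=1}^nf(X_i^1,\dots,X_i^d)-\frac1{n^d}\sum_{(i_1,\dots,i_d)\in[n]^d}f(X_{i_1}^1,\dots,X_{i_d}^d)\Big\}.$$ For a $d$-tuple $\boldsymbol\pi=(\pi^1,\dots,\pi^d)$ of permutations of $[n]$, $\mathcal X_n^{\boldsymbol\pi}$ has $i$-th element $(X^1_{\pi^1(i)},\dots,X^d_{\pi^d(i)})$. dpdHSIC test: $\xi_{\epsilon,\delta}=\epsilon+\log(1/(1-\delta))$, $\Delta_T=2d\sqrt{K_0}/n$; $\boldsymbol\pi_0$ is the identity, $\boldsymbol\pi_1,\dots,\boldsymbol\pi_B$ are i.i.d. uniform $d$-tuples of permutations, $\zeta_0,\dots,\zeta_B$ are i.i.d. standard Laplace (location $0$, scale $1$), all independent of each other and of the data. $M_i=\widehat{\mathrm{dHSIC}}(\mathcal X_n^{\boldsymbol\pi_i})+2\Delta_T\xi_{\epsilon,\delta}^{-1}\zeta_i$, $\hat p_{\mathrm{dp}}=\frac1{B+1}\{\sum_{i=1}^B\mathbb 1(M_i\ge M_0)+1\}$, $\phi_{\mathrm{dpdHSIC}}=\mathbb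 1(\hat p_{\mathrm{dp}}\le\alpha)$. For $\rho>0$, $\mathcal P_{\mathrm{dHSIC}_{\mathbf k}}(\rho)$ is the set of distributions $P$ on $\mathbb X^1\times\dots\times\mathbb X^d$ with $\mathrm{dHSIC}_{\mathbf k}(P)\ge\rho$, and $$\rho_{\phi_{\mathrm{dpdHSIC}}}(\alpha,\beta,\epsilon,\delta,n)=\inf\Big\{\rho>0:\sup_{P\in\mathcal P_{\mathrm{dHSIC}_{\mathbf k}}(\rho)}\mathbb E_P[1-\phi_{\mathrm{dpdHSIC}}]\le\beta\Big\}$$ (a supremum over an empty class is read as $0$). *)

(* Defs.v *)
From HB Require Import structures.
From mathcomp Require Import all_boot all_order all_algebra all_fingroup.
From mathcomp Require Import sesquilinear.
From mathcomp Require Import all_classical all_reals all_analysis.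
From mathcomp Require Import measurable_realfun.

Set Implicit Arguments.
Unset Strict Implicit.
Unset Printing Implicit Defensive.
Import Order.TTheory GRing.Theory Num.Theory.
Import numFieldNormedType.Exports.
Local Open Scope classical_set_scope.
Local Open Scope ring_scope.

(* Dependent functions, with the sigma-algebra generated by the coordinate
   projections. *)
Section product_space.
Context {I : Type} {disp : I -> measure_display}.
Variable T : forall i, measurableType (disp i).

Definition cylinder : set (set (forall i, T i)) :=
  \bigcup_i preimage_set_system setT (fun x : forall i, T i => x i) measurable.

Definition prodspace : Type := forall i, T i.

HB.instance Definition _ := Pointed.on prodspace.
HB.instance Definition _ := @isMeasurable.Build (sigma_display cylinder)
  prodspace <<s cylinder >> (@sigma_algebra0 _ setT cylinder)
  (@sigma_algebraC _ cylinder) (@sigma_algebra_bigcup _ setT cylinder).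

Definition pcoord (i : I) (x : prodspace) : T i := x i.

Lemma measurable_pcoord i : measurable_fun setT (@pcoord i).
Proof.
move=> _ A mA; apply: sub_sigma_algebra.
by exists i => //; exists A.
Qed.

HB.instance Definition _ i :=
  isMeasurableFun.Build _ _ _ _ (@pcoord i) (@measurable_pcoord i).

Lemma measurable_fun_prodspace d' (S : measurableType d') (f : S -> prodspace) :
  (forall i, measurable_fun setT (@pcoord i \o f)) -> measurable_fun setT f.
Proof.
move=> mf; apply: (@measurability _ _ S prodspace setT f cylinder) => //.
move=> _ [_ [i _ [A mA <-]] <-].
by have := mf i measurableT A mA; rewrite !setTI.
Qed.

End product_space.

(* The product of the probabilities mu i: starting from an arbitrary point,
   every coordinate i is redrawn in turn from mu i, independently of the rest.
   Lemma prod_prob_box is the characteristic property. *)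
Section product_probability.
Context {R : realType} {I : finType} {disp : I -> measure_display}.
Context {T : forall i, measurableType (disp i)}.

Definition redraw (i : I) (p : T i * prodspace T) : prodspace T :=
  dfwith p.2 i p.1.

Lemma measurable_redraw i : measurable_fun setT (@redraw i).
Proof.
apply: measurable_fun_prodspace => j; have [<-|ij] := eqVneq i j.
  rewrite (_ : _ \o _ = fst); first exact: measurable_fst.
  by apply/funext => -[y x]; rewrite /pcoord /redraw /= dfwithin.
rewrite (_ : _ \o _ = @pcoord _ _ T j \o snd); last first.
  by apply/funext => -[y x]; rewrite /pcoord /redraw /= dfwithout.
by apply: measurableT_comp; [exact: measurable_pcoord|exact: measurable_snd].
Qed.

HB.instance Definition _ i :=
  isMeasurableFun.Build _ _ _ _ (@redraw i) (@measurable_redraw i).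

Variable mu : forall i, probability (T i) R.

Definition redraw_all (s : seq I) : probability (prodspace T) R :=
  foldr (fun i (m : probability (prodspace T) R) =>
           distribution (mu i \x m)%E (@redraw i)) (dirac point) s.

Definition prod_prob : probability (prodspace T) R := redraw_all (enum I).

Lemma measurable_box (s : seq I) (A : forall i, set (T i)) :
  (forall i, measurable (A i)) ->
  measurable [set x : prodspace T | forall i, i \in s -> A i (x i)].
Proof.
move=> mA; elim: s => [|j s IHs].
  by rewrite (_ : [set _ | _] = setT)//; apply/seteqP; split.
rewrite (_ : [set _ | _] =
  (@pcoord _ _ T j @^-1` A j) `&`
  [set x : prodspace T | forall i, i \in s -> A i (x i)]); last first.
  apply/seteqP; split => x /=.
    move=> xA; split; first by apply: xA; rewrite mem_head.
    by move=> i si; apply: xA; rewrite inE si orbT.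
  by move=> [xj xs] i; rewrite inE => /predU1P[->//|]; exact: xs.
apply: measurableI => //; rewrite -[X in measurable X]setTI.
exact: measurable_pcoord.
Qed.

Lemma prod_prob_box (A : forall i, set (T i)) :
  (forall i, measurable (A i)) ->
  prod_prob [set x | forall i, A i (x i)] = (\prod_i mu i (A i))%E.
Proof.
move=> mA.
suff H s : uniq s -> redraw_all s [set x | forall i, i \in s -> A i (x i)] =
    (\prod_(i <- s) mu i (A i))%E.
  have := H _ (enum_uniq I); rewrite big_enum/= => <-.
  congr (_ _); apply/seteqP; split => x /= xA i; first by move=> _; exact: xA.
  by apply: xA; rewrite mem_enum.
elim: s => [_|j s IHs /= /andP[js us]].
  by rewrite big_nil -[RHS](probability_setT (redraw_all [::])); congr (_ _);
     apply/seteqP; split.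
rewrite big_cons -(IHs us) /distribution /pushforward.
rewrite -product_measure1E//; last exact: measurable_box.
congr (_ _); apply/seteqP; split => -[y x] /=; rewrite /redraw /=.
  move=> xA; split; first by have := xA j (mem_head _ _); rewrite dfwithin.
  move=> i si; have := xA i; rewrite inE si orbT dfwithout; first exact.
  by apply: contraNneq js => ->.
move=> [yA xA] i; rewrite inE => /predU1P[->|si]; first by rewrite dfwithin.
rewrite dfwithout; first exact: xA.
by apply: contraNneq js => ->.
Qed.

End product_probability.

Section laplace.
Context {R : realType}.
Local Open Scope ereal_scope.
Notation mu := (@lebesgue_measure R).

Definition laplace_pdf (x : R) : R := (2^-1 * expR (- `|x|))%R.

Definition laplace_prob (V : set R) : \bar R :=
  \int[mu]_(x in V) (laplace_pdf x)%:E.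

Lemma laplace_pdf_ge0 x : (0 <= laplace_pdf x)%R.
Proof. by rewrite mulr_ge0// expR_ge0. Qed.

Lemma continuous_laplace_pdf : continuous laplace_pdf.
Proof.
move=> x; apply: (@continuousM R R^o (fun=> 2^-1%R) (fun x => expR (- `|x|)%R)).
  exact: cst_continuous.
apply: continuous_comp; last exact: continuous_expR.
by apply: (@continuousN _ R^o); exact: norm_continuous.
Qed.

Lemma measurable_laplace_pdf : measurable_fun setT laplace_pdf.
Proof. exact: continuous_measurable_fun continuous_laplace_pdf. Qed.

Let laplace0 : laplace_prob set0 = 0.
Proof. by rewrite /laplace_prob integral_set0. Qed.

Let laplace_ge0 A : 0 <= laplace_prob A.
Proof. by apply: integral_ge0 => x _; rewrite lee_fin laplace_pdf_ge0. Qed.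

Let laplace_sigma_additive : semi_sigma_additive laplace_prob.
Proof.
move=> /= F mF tF mUF; rewrite /laplace_prob; apply: cvg_toP.
  apply: ereal_nondecreasing_is_cvgn => m n mn.
  by apply: lee_sum_nneg_natr => // k _ _; exact: laplace_ge0.
rewrite ge0_integral_bigcup//=.
- apply/measurable_funTS/measurableT_comp => //.
  exact: measurable_laplace_pdf.
- by move=> x _; rewrite lee_fin laplace_pdf_ge0.
Qed.

HB.instance Definition _ := isMeasure.Build _ _ _
  laplace_prob laplace0 laplace_ge0 laplace_sigma_additive.

Let laplace_setT : laplace_prob [set: R] = 1.
Proof.
rewrite /laplace_prob ge0_symfun_integralT; [|exact: laplace_pdf_ge0|
  exact: continuous_laplace_pdf|by move=> x; rewrite /laplace_pdf /= normrN].
rewrite (_ : [set x | _] = `[0%R, +oo[%classic); last first.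
  by apply/seteqP; split => x/=; rewrite in_itv/= andbT.
have int1 : \int[mu]_(x in `[0%R, +oo[) (1 * expR (- 1 * x))%:E = 1.
  rewrite -[RHS](integral_exponential_pdf (@ltr01 R)) integral_mkcond.
  by apply: eq_integral => x _; rewrite /exponential_pdf !patchE; case: ifP.
transitivity (2%:E * \int[mu]_(x in `[0%R, +oo[)
    ((2^-1)%:E * (1 * expR (- 1 * x))%:E)).
  congr (_ * _); apply: eq_integral => x; rewrite inE/= in_itv/= andbT => x0.
  by rewrite -EFinM /laplace_pdf ger0_norm// mulN1r mul1r.
rewrite ge0_integralZl//=.
- by rewrite int1 mule1 -EFinM divff.
- apply: measurable_funTS; apply/measurable_EFinP; apply: measurable_funM => //.
  by apply: measurableT_comp => //; apply: measurable_funM.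
Qed.

HB.instance Definition _ :=
  @Measure_isProbability.Build _ _ R laplace_prob laplace_setT.

End laplace.

Definition separable_space (X : topologicalType) : Prop :=
  exists D : set X, countable D /\ dense D.

Definition borel (X : ptopologicalType) := g_sigma_algebraType (@open X).

Section kernels.
Context {R : realType}.

Definition psd_kernel (X : Type) (k : X -> X -> R) : Prop :=
  (forall x y, k x y = k y x) /\
  forall (m : nat) (x : 'I_m -> X) (c : 'I_m -> R),
    0 <= \sum_i \sum_j c i * c j * k (x i) (x j).

Definition continuous_kernel (X : topologicalType) (k : X -> X -> R) : Prop :=
  continuous (fun p : X * X => k p.1 p.2).

Definition bounded_kernel (X : Type) (k : X -> X -> R) : Prop :=
  exists M : R, forall x y, `|k x y| <= M.

(* The reproducing kernel Hilbert space of k: a Hilbert space whose elements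
   are (through the injection rkhs_fun) functions on X, which contains the
   sections of k and has the reproducing property. Linearity of rkhs_fun
   follows from the latter. *)
Record rkhs (X : Type) (k : X -> X -> R) := Rkhs {
  rkhs_space :> completeNormedModType R;
  rkhs_dot : {dot rkhs_space for idfun};
  rkhs_normE : forall h, `|h| ^+ 2 = rkhs_dot h h;
  rkhs_fun : rkhs_space -> X -> R;
  rkhs_fun_inj : injective rkhs_fun;
  rkhs_section : X -> rkhs_space;
  rkhs_sectionE : forall x, rkhs_fun (rkhs_section x) = k^~ x;
  rkhs_reproducing : forall h x, rkhs_fun h x = rkhs_dot h (rkhs_section x) }.

Definition unit_ball (X : Type) (k : X -> X -> R) (H : rkhs k) : set (X -> R) :=
  [set rkhs_fun h | h in [set h : H | `|h| <= 1]].

(* Injectivity of the kernel mean embedding P |-> E_P[k(., X)]. Equality of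
   probabilities is stated on measurable sets, as a set function of the
   library is unconstrained on the other ones. *)
Definition characteristic_kernel d (X : measurableType d) (k : X -> X -> R) : Prop :=
  forall P Q : probability X R,
    (forall y, 'E_P[k^~ y] = 'E_Q[k^~ y])%E ->
    forall A, measurable A -> P A = Q A.

End kernels.

Section dhsic.
Context {R : realType} {d : nat}.

(* The Borel sets of the factors generate the sigma-algebra of the product. *)
Definition obs (X : 'I_d -> ptopologicalType) := prodspace (fun j => borel (X j)).

Variable X : 'I_d -> ptopologicalType.

Definition tensor_kernel (k : forall j, X j -> X j -> R) (x y : obs X) : R :=
  \prod_j k j (x j) (y j).

Definition marginal (P : probability (obs X) R) (j : 'I_d) :
    probability (borel (X j)) R :=
  distribution P (@pcoord _ _ (fun j => borel (X j)) j).

Variables (k : forall j, X j -> X j -> R) (H : rkhs (tensor_kernel k)).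

Definition dHSIC (P : probability (obs X) R) : \bar R :=
  ereal_sup [set ('E_P[f] - 'E_(prod_prob (marginal P))[f])%E
            | f in unit_ball H].

Definition dHSIC_sample (n : nat) (x : 'I_n -> obs X) : R :=
  sup [set n%:R^-1 * (\sum_i f (x i)) -
           (n ^ d)%:R^-1 *
             (\sum_(s : {ffun 'I_d -> 'I_n}) f (fun j => x (s j) j))
      | f in unit_ball H].

Definition permute_sample (n : nat) (pi : {ffun 'I_d -> 'S_n})
    (x : 'I_n -> obs X) : 'I_n -> obs X :=
  fun i j => x (pi j i) j.

(* Permutation tuples number 1, ..., B are pi 0, ..., pi (B - 1); number 0 is
   the identity. *)
Definition add_identity (n B : nat) (pi : {ffun 'I_B -> {ffun 'I_d -> 'S_n}})
    (i : 'I_B.+1) : {ffun 'I_d -> 'S_n} :=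
  if unlift ord0 i is Some b then pi b else [ffun=> 1%g].

Definition privacy (eps delta : R) : R := eps + ln (1 / (1 - delta)).

Definition sensitivity (K : 'I_d -> R) (n : nat) : R :=
  2 * d%:R * Num.sqrt (\prod_j K j) / n%:R.

Section test.
Variables (K : 'I_d -> R) (alpha eps delta : R) (n B : nat).

Definition dpM (pi : {ffun 'I_B -> {ffun 'I_d -> 'S_n}}) (x : 'I_n -> obs X)
    (zeta : 'I_B.+1 -> R) (i : 'I_B.+1) : R :=
  dHSIC_sample (permute_sample (add_identity pi i) x) +
  2 * sensitivity K n * (privacy eps delta)^-1 * zeta i.

Definition dp_pvalue (pi : {ffun 'I_B -> {ffun 'I_d -> 'S_n}})
    (x : 'I_n -> obs X) (zeta : 'I_B.+1 -> R) : R :=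
  B.+1%:R^-1 *
  ((\sum_(i < B.+1 | i != ord0) ((dpM pi x zeta ord0 <= dpM pi x zeta i)%R)%:R) + 1).

Definition dpdHSIC_test (pi : {ffun 'I_B -> {ffun 'I_d -> 'S_n}})
    (x : 'I_n -> obs X) (zeta : 'I_B.+1 -> R) : R :=
  ((dp_pvalue pi x zeta <= alpha)%R)%:R.

(* E_P[1 - phi]: the B permutation tuples are i.i.d. uniform, so their joint
   law is uniform on the finite set of B-tuples of them; the sample has law
   P^n and the noise Laplace^(B+1), and the three are independent. *)
Definition type2_error (P : probability (obs X) R) : \bar R :=
  ((#|{ffun 'I_B -> {ffun 'I_d -> 'S_n}}|%:R^-1)%:E *
   \sum_(pi : {ffun 'I_B -> {ffun 'I_d -> 'S_n}})
     'E_(prod_prob (fun _ : 'I_n => P) \x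
         prod_prob (fun _ : 'I_B.+1 => laplace_prob))
       [fun w => (1 - dpdHSIC_test pi w.1 w.2)%R])%E.

(* The type II error is nonnegative, so the outer maximum only serves to read
   the supremum over an empty class as 0. *)
Definition worst_type2_error (rho : R) : \bar R :=
  maxe (0 : \bar R)%E (ereal_sup [set type2_error P | P in [set P | (rho%:E <= dHSIC P)%E]]).

Definition min_separation (beta : R) : \bar R :=
  ereal_inf [set rho%:E | rho in
    [set rho : R | 0 < rho /\ (worst_type2_error rho <= beta%:E)%E]].

End test.

End dhsic.

(* Main.v *)
From HB Require Import structures.
Require Import Defs.
From mathcomp Require Import all_boot all_order all_algebra all_fingroup.
From mathcomp Require Import all_classical all_reals all_analysis.
From mathcomp Require Import ring lra sesquilinear measurable_realfun.
Import Order.TTheory GRing.Theory Num.Theory.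
Import numFieldNormedType.Exports.
Local Open Scope classical_set_scope.
Local Open Scope ring_scope.
Set Implicit Arguments.
Unset Strict Implicit.
Unset Printing Implicit Defensive.

(** Let [M] bound the square root of the tensor kernel on the diagonal, so that
    every function of the unit ball is bounded by [M], and let [r] be the
    maximum in the claimed bound. The separation [256 * d ^ 2 * M * r] is enough
    for three reasons.

    The statistic of the data is large. It is a supremum over the unit ball, so
    a lower bound only needs one fixed function [f] of the ball whose gap between
    [P] and the product of its marginals is at least half of the separation
    ([dHSIC_witness]). The empirical gap of [f] is a function of independent
    observations with differences of order [d * M / n]; McDiarmid's inequality
    ([gap_lower_tail]) keeps it within [21 * M * d * r] of its mean, and the mean
    differs from the population gap by the contribution of index tuples with a
    repetition, of order [M * d ^ 2 / n] ([mean_gap_ge]).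

    The permuted statistics are small, whatever the data. For a fixed sample the
    permuted statistic is the norm of an average centred under random
    permutations, hence of order [M / sqrt n] in mean ([avg_dHSIC_permute_le]; this
    is where the nonnegativity of the kernels enters), and it changes by at most
    [4 * M / n] when one permutation is composed with a transposition. The
    martingale method for uniform permutations ([avg_expR_perm_le]), tensorised
    over the [d] components ([avg_expR_ffun_le]), gives a subgaussian tail: it
    exceeds [72 * M * d * r] with probability at most [alpha / 32]
    ([dHSIC_permute_tail]).

    The noise is small: by the exponential tail of the Laplace law, the noise
    added to a statistic is of order [M * d * r], again up to a probability
    proportional to [alpha] for the permuted statistics.

    When the statistic of the data is large, the p-value exceeds [alpha] only if
    at least [alpha * (B + 1) - 1] of the [B] indices have a large permuted
    statistic or a large noise. Conditionally on the data these events have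
    probability at most [alpha / 32] each and are independent over the indices, so
    a Chernoff bound and the lower bound on [B] make this unlikely
    ([type2_error_split], [count_tail_le]).

    Measurability of the statistic, a supremum over an infinite ball, is
    bypassed. The average over permutations is taken pointwise in the data and
    the noise, where it has a measurable majorant; the integral of a nonnegative
    function being defined as a lower integral, it is superadditive, which is the
    direction needed to move the finite average inside
    ([ge0_lower_integral_sum], [type2_error_le_mean]). The single function [f]
    is measurable because functions of the Hilbert space are pointwise limits of
    combinations of sections of the kernel ([rkhs_fun_lim_section_comb]). *)

(** * Subgaussian bounds for averages over finite types *)

(** For a centred variable [y] bounded by [c], taking means gives the subgaussian
    bound [expR (2 * c ^ 2)] on the exponential moment. The constant 2 is not
    optimal, but leaves only elementary cases: [expR y <= 1 / (1 - y)] when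
    [`|y| <= 1 / 2], and [`|y| <= 2 * y ^ 2] otherwise. *)
Lemma expR_le_quadratic (R : realType) (y : R) : expR y <= y + expR (2 * y ^+ 2).
Proof.
have q : 1 + 2 * y ^+ 2 <= expR (2 * y ^+ 2) by exact: expR_ge1Dx.
have [ygt|yle] := ltP (1 / 2) y.
  have : expR y <= expR (2 * y ^+ 2) by rewrite ler_expR; nra.
  by lra.
have [ylt|yge] := ltP y (- (1 / 2)).
  have : expR y <= 1 by rewrite -expR0 ler_expR; lra.
  by nra.
have e1 : expR y * (1 - y) <= 1.
  rewrite -[leRHS](expRxMexpNx_1 y) ler_wpM2l ?expR_ge0//.
  exact: expR_ge1Dx.
have : expR y <= 1 + y + 2 * y ^+ 2.
  have -> : expR y = expR y * (1 - y) / (1 - y) by field; lra.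
  rewrite ler_pdivrMr; last lra.
  by apply: (le_trans e1); nra.
by lra.
Qed.

Section average.
Context {R : realType}.

Definition avg (T : finType) (F : T -> R) : R := #|T|%:R^-1 * \sum_x F x.

Variable T : finType.
Implicit Types F G : T -> R.

Lemma eq_avg F G : F =1 G -> avg F = avg G.
Proof. by move=> FG; congr (_ * _); apply: eq_bigr => x _; exact: FG. Qed.

Lemma ler_avg F G : (forall x, F x <= G x) -> avg F <= avg G.
Proof.
by move=> FG; rewrite ler_wpM2l ?invr_ge0 ?ler0n//; apply: ler_sum => x _.
Qed.

Lemma avg_ge0 F : (forall x, 0 <= F x) -> 0 <= avg F.
Proof.
by move=> F0; rewrite mulr_ge0 ?invr_ge0 ?ler0n//; apply: sumr_ge0 => x _.
Qed.

Lemma avgD F G : avg (fun x => F x + G x) = avg F + avg G.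
Proof. by rewrite /avg big_split mulrDr. Qed.

Lemma avgN F : avg (fun x => - F x) = - avg F.
Proof. by rewrite /avg sumrN mulrN. Qed.

Lemma avgZ a F : avg (fun x => a * F x) = a * avg F.
Proof. by rewrite /avg -mulr_sumr mulrCA. Qed.

Lemma avg_sum (I : finType) (F : I -> T -> R) :
  avg (fun x => \sum_i F i x) = \sum_i avg (F i).
Proof. by rewrite /avg exchange_big mulr_sumr. Qed.

Lemma avg_swap (S : finType) (F : S -> T -> R) :
  avg (fun x => avg (F ^~ x)) = avg (fun y => avg (F y)).
Proof.
rewrite /avg -!mulr_sumr mulrCA; congr (_ * (_ * _)); exact: exchange_big.
Qed.

Lemma avg_bij (h : T -> T) F : injective h -> avg (F \o h) = avg F.
Proof. by move=> h_inj; rewrite /avg [in RHS](reindex_inj h_inj). Qed.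

Hypothesis T0 : (0 < #|T|)%N.

Lemma avg_cst a : avg (fun _ : T => a) = a.
Proof.
by rewrite /avg sumr_const -[a *+ _]mulr_natl mulKf// pnatr_eq0 -lt0n.
Qed.

Lemma le_avg_sqr F : avg F ^+ 2 <= avg (fun x => F x ^+ 2).
Proof.
have : 0 <= avg (fun x => F x ^+ 2 + (- (2 * avg F)) * F x + avg F ^+ 2).
  apply: avg_ge0 => x.
  by rewrite (_ : _ + _ = (F x - avg F) ^+ 2) ?sqr_ge0//; ring.
by rewrite !avgD avgZ avg_cst; lra.
Qed.

Lemma avg_expR_le F c : (forall x y, F x - F y <= c) ->
  avg (fun x => expR (F x)) <= expR (avg F + 2 * c ^+ 2).
Proof.
move=> Fc; set m := avg F.
have Fm x : `|F x - m| <= c.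
  have : avg (fun y => F x - F y) <= c.
    by rewrite -(avg_cst c); apply: ler_avg => y.
  have : avg (fun y => F y - F x) <= c.
    by rewrite -(avg_cst c); apply: ler_avg => y.
  rewrite [X in X <= _ -> _]avgD [X in _ -> X <= _ -> _]avgD !avg_cst.
  by rewrite avgN ler_norml -/m; lra.
have le x : expR (F x) <= expR m * (F x - m + expR (2 * c ^+ 2)).
  rewrite -[F x in X in X <= _](subrKC m) expRD ler_wpM2l ?expR_ge0//.
  apply: (le_trans (expR_le_quadratic _)); rewrite lerD2l ler_expR.
  by rewrite ler_pM2l ?ltr0n// -real_normK ?num_real// ler_pXn2r ?nnegrE//
     (le_trans _ (Fm x)).
apply: (le_trans (ler_avg le)); rewrite avgZ !avgD !avg_cst expRD.
by rewrite subrr add0r.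
Qed.

End average.

Section redraw_coordinate.
Context {R : realType} {I T : finType}.
Implicit Types (p : {ffun I -> T}) (F : {ffun I -> T} -> R).

Definition set_coord p j u : {ffun I -> T} :=
  [ffun k => if k == j then u else p k].

(** Exchanging the drawn value with the value it replaces is an involution of
    the pairs formed by a function and a value. *)
Lemma avg_redraw j F : avg F = avg (fun p => avg (fun u => F (set_coord p j u))).
Proof.
have [T0|T0] := posnP #|T|; last first.
  transitivity (avg (fun p => #|T|%:R^-1 * (#|T|%:R * F p))).
    by apply: eq_avg => p; rewrite mulKf// pnatr_eq0 -lt0n.
  rewrite /avg -!mulr_sumr; congr (_ * (_ * _)).
  pose h (q : {ffun I -> T} * T) := (set_coord q.1 j q.2, q.1 j).
  have hK : involutive h.
    move=> [p u]; rewrite /h /= ffunE eqxx; congr (_, _).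
    by apply/ffunP => k; rewrite !ffunE; case: eqVneq => [->|].
  rewrite pair_big (reindex_inj (inv_inj hK)) /=.
  rewrite -(pair_big xpredT xpredT
    (fun p u => F (set_coord (set_coord p j u) j (p j)))) /=.
  rewrite mulr_sumr; apply: eq_bigr => p _.
  rewrite (eq_bigr (fun=> F p)) ?sumr_const ?mulr_natl// => u _; congr F.
  by apply/ffunP => k; rewrite !ffunE; case: eqVneq => [->|].
rewrite /avg !big1 ?mulr0// => p _.
  by rewrite T0 invr0 mul0r.
by have /card0_eq/(_ (p j)) := T0.
Qed.

Hypothesis T0 : (0 < #|T|)%N.

Let D0 : (0 < #|{: {ffun I -> T}}|)%N.
Proof. by rewrite card_ffun expn_gt0 T0. Qed.

(** Each coordinate averaged out costs the factor [expR v] of the one-coordinate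
    bound, and leaves a function that still has bounded differences but depends
    on one coordinate less. The relation [nbr] abstracts from the moves along
    which differences are bounded, which are transpositions in the application. *)
Lemma avg_expR_ffun_le (nbr : T -> T -> Prop) (c v : R) F : 0 <= c ->
  (forall g : T -> R, (forall x y, nbr x y -> g x - g y <= c) ->
    avg (fun x => expR (g x)) <= expR (avg g + v)) ->
  (forall p j u u', nbr u u' -> F (set_coord p j u) - F (set_coord p j u') <= c) ->
  avg (fun p => expR (F p)) <= expR (avg F + v *+ #|I|).
Proof.
move=> c0 step Fc.
suff H s (G : {ffun I -> T} -> R) :
    uniq s -> (forall p q : {ffun I -> T}, {in s, p =1 q} -> G p = G q) ->
    (forall p j u u', nbr u u' -> G (set_coord p j u) - G (set_coord p j u') <= c) ->
    avg (fun p => expR (G p)) <= expR (avg G + v *+ size s).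
  rewrite cardE; apply: H => //; first exact: enum_uniq.
  by move=> p q pq; congr F; apply/ffunP => i; rewrite pq// mem_enum.
elim: s G => [|i s IHs] G.
  move=> _ Gdep _; rewrite addr0.
  have /card_gt0P[p0 _] := D0.
  rewrite (eq_avg (G := fun=> expR (G p0))); last first.
    by move=> p; rewrite (Gdep p p0).
  by rewrite (eq_avg (F := G) (G := fun=> G p0)) ?avg_cst// => p; exact: Gdep.
move=> /= /andP[si us] Gdep Gc.
pose A p := avg (fun u => G (set_coord p i u)).
rewrite (avg_redraw i G) (avg_redraw i) -/A.
apply: (@le_trans _ _ (avg (fun p => expR (A p + v)))).
  by apply: ler_avg => p; apply: step => x y; exact: Gc.
rewrite (eq_avg (G := fun p => expR v * expR (A p))); last first.
  by move=> p; rewrite expRD mulrC.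
rewrite avgZ mulrS addrCA expRD ler_wpM2l ?expR_ge0//; apply: IHs => //.
  move=> p q pq; apply: eq_avg => u; apply: Gdep => k.
  by rewrite inE !ffunE; case: eqVneq => //= _; exact: pq.
move=> p j u u' uu'.
rewrite /A -avgN -avgD -(avg_cst T0 c); apply: ler_avg => w.
have [ij|ij] := eqVneq i j.
  have E z : set_coord (set_coord p j z) i w = set_coord p i w.
    by apply/ffunP => k; rewrite !ffunE ij; case: eqVneq.
  by rewrite !E subrr.
have E z : set_coord (set_coord p j z) i w = set_coord (set_coord p i w) j z.
  apply/ffunP => k; rewrite !ffunE; case: eqVneq => // ->.
  by rewrite (negbTE ij).
by rewrite !E; exact: Gc.
Qed.

End redraw_coordinate.

Section permutations.
Context {R : realType} {T : finType}.
Local Open Scope group_scope.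

(** The martingale method: the values of the permutation are averaged out one
    point at a time. Composing with the transpositions of a point [i] with the
    points that remain to be averaged out makes the value at [i] uniform among
    the values not taken at the other points, so the average no longer depends on
    it. Conjugation turns transpositions into transpositions, hence the average
    still has bounded differences. *)
Lemma avg_expR_perm_le (c : R) (F : {perm T} -> R) : 0 <= c ->
  (forall p a b, F (tperm a b * p) - F p <= c) ->
  avg (fun p => expR (F p)) <= expR (avg F + (2 * (c + c) ^+ 2) *+ #|T|)%R.
Proof.
move=> c0 Fc; set v := (2 * (c + c) ^+ 2)%R.
have P0 : (0 < #|{: {perm T}}|)%N by apply/card_gt0P; exists 1.
suff H s (G : {perm T} -> R) :
    uniq s -> (forall p q : {perm T}, {in s, p =1 q} -> G p = G q) ->
    (forall p a b, G (tperm a b * p) - G p <= c) ->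
    avg (fun p => expR (G p)) <= expR (avg G + v *+ size s).
  rewrite cardE; apply: H => //; first exact: enum_uniq.
  by move=> p q pq; congr F; apply/permP => i; rewrite pq// mem_enum.
elim: s G => [|i s IHs] G.
  move=> _ Gdep _; rewrite addr0.
  rewrite (eq_avg (G := fun=> expR (G 1))); last first.
    by move=> p; rewrite (Gdep p 1).
  by rewrite (eq_avg (F := G) (G := fun=> G 1)) ?avg_cst// => p; exact: Gdep.
move=> /= /andP[si us] Gdep Gc.
pose U := {u : T | u \notin s}.
have U0 : (0 < #|{: U}|)%N by apply/card_gt0P; exists (Sub i si).
pose A p := avg (fun u : U => G (tperm i (val u) * p)).
have avgA (g : {perm T} -> R) :
    avg g = avg (fun p => avg (fun u : U => g (tperm i (val u) * p))).
  rewrite avg_swap -(avg_cst U0 (avg g)); apply: eq_avg => u.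
  by rewrite (avg_bij g (mulgI (tperm i (val u)))).
rewrite (avgA G) avgA -/A.
apply: (@le_trans _ _ (avg (fun p => expR (A p + v)))).
  apply: ler_avg => p; apply: avg_expR_le => // u w.
  rewrite -[G (_ * p)](subrK (G p)) -addrA lerD//.
  rewrite -[p in X in X - _ <= _](mulKg (tperm i (val w))) tpermV; exact: Gc.
rewrite (eq_avg (G := fun p => expR v%R * expR (A p))%R); last first.
  by move=> p; rewrite expRD mulrC.
rewrite avgZ mulrS addrCA expRD ler_wpM2l ?expR_ge0//; apply: IHs => //.
  move=> p q pq.
  have hP (u : U) : q^-1 (p (val u)) \notin s.
    apply/negP => ks; have := pq _ ks; rewrite permKV => /perm_inj e.
    by move: ks; rewrite e (negbTE (valP u)).
  pose h (u : U) : U := exist (fun u => u \notin s) _ (hP u).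
  have h_inj : injective h.
    by move=> u w /(congr1 val) /= /perm_inj /perm_inj; exact: val_inj.
  rewrite /A -[RHS](avg_bij _ h_inj); apply: eq_avg => u /=; apply: Gdep => k.
  rewrite inE !permM => /predU1P[->|ks]; first by rewrite !tpermL permKV.
  have ik : i != k by apply: contraNneq si => ->.
  have uk (w : U) : val w != k by apply: contraNneq (valP w) => ->.
  by rewrite (tpermD ik (uk u)) (tpermD ik (uk (h u))) pq.
move=> p a b; rewrite /A -avgN -avgD -(avg_cst U0 c); apply: ler_avg => u.
by rewrite mulgA (conjgCV (tperm i _)) tpermV tpermJ -mulgA; exact: Gc.
Qed.

End permutations.

(** * Reproducing kernel Hilbert spaces *)

Section rkhs_theory.
Context {R : realType} {X : Type} {k : X -> X -> R} (H : rkhs k).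
Notation dot := (rkhs_dot H).
Notation phi := (@rkhs_section _ _ _ H).
Implicit Types g h u : H.

Lemma rkhs_dotC g h : dot g h = dot h g.
Proof. by rewrite hermC mul1r. Qed.

Lemma rkhs_dot0l u : dot 0 u = 0.
Proof. by rewrite linear0l. Qed.

Lemma rkhs_dotDl g h u : dot (g + h) u = dot g u + dot h u.
Proof. by rewrite linearDl. Qed.

Lemma rkhs_dotZl a g u : dot (a *: g) u = a * dot g u.
Proof. by rewrite linearZl_LR. Qed.

Lemma rkhs_dotNl g u : dot (- g) u = - dot g u.
Proof. by rewrite -scaleN1r rkhs_dotZl mulN1r. Qed.

Lemma rkhs_dotDr g h u : dot u (g + h) = dot u g + dot u h.
Proof. by rewrite linearDr. Qed.

Lemma rkhs_dotZr a g u : dot u (a *: g) = a * dot u g.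
Proof. by rewrite linearZr_LR. Qed.

Lemma rkhs_dot_suml (I : Type) (r : seq I) (f : I -> H) u :
  dot (\sum_(i <- r) f i) u = \sum_(i <- r) dot (f i) u.
Proof.
elim: r => [|i r IHr]; last by rewrite !big_cons rkhs_dotDl IHr.
by rewrite !big_nil rkhs_dot0l.
Qed.

Lemma rkhs_norm_sqrB g a u :
  `|g - a *: u| ^+ 2 = `|g| ^+ 2 - 2 * a * dot g u + a ^+ 2 * `|u| ^+ 2.
Proof.
rewrite !rkhs_normE -scaleNr !(rkhs_dotDl, rkhs_dotDr, rkhs_dotZl, rkhs_dotZr).
by rewrite (rkhs_dotC u g); ring.
Qed.

Lemma rkhs_cauchy_schwarz g h : dot g h <= `|g| * `|h|.
Proof.
have [->|h0] := eqVneq h 0.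
  by rewrite normr0 mulr0 rkhs_dotC rkhs_dot0l.
have h1 : 0 < `|h| by rewrite normr_gt0.
have [g0|g0] := eqVneq g 0.
  by rewrite g0 normr0 mul0r rkhs_dot0l.
have g1 : 0 < `|g| by rewrite normr_gt0.
have : 0 <= `| `|h| *: g - `|g| *: h| ^+ 2 by rewrite sqr_ge0.
rewrite rkhs_norm_sqrB rkhs_dotZl normrZ normr_id.
rewrite (_ : _ + _ = 2 * (`|g| * `|h|) * (`|g| * `|h| - dot g h)); last ring.
by rewrite pmulr_rge0 ?subr_ge0// !mulr_gt0.
Qed.

Lemma rkhs_dot_section x y : dot (phi x) (phi y) = k y x.
Proof. by rewrite -rkhs_reproducing rkhs_sectionE. Qed.

Lemma rkhs_norm_section x : `|phi x| ^+ 2 = k x x.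
Proof. by rewrite rkhs_normE rkhs_dot_section. Qed.

Lemma rkhs_fun_norm_le (M : R) h x : 0 <= M -> k x x <= M ^+ 2 -> `|h| <= 1 ->
  `|rkhs_fun h x| <= M.
Proof.
move=> M0 kM h1.
have phiM : `|phi x| <= M.
  by rewrite -(ler_pXn2r (n := 2)) ?nnegrE ?normr_ge0// rkhs_norm_section.
have le g : `|g| <= 1 -> rkhs_fun g x <= M.
  move=> g1; rewrite rkhs_reproducing (le_trans (rkhs_cauchy_schwarz _ _))//.
  by rewrite -[leRHS]mul1r ler_pM.
rewrite ler_norml le// andbT lerNl.
by have := le (- h); rewrite normrN !rkhs_reproducing rkhs_dotNl; exact.
Qed.

Definition section_comb (l : seq (R * X)) : H := \sum_(p <- l) p.1 *: phi p.2.

Lemma rkhs_fun_section_comb l x :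
  rkhs_fun (section_comb l) x = \sum_(p <- l) p.1 * k x p.2.
Proof.
rewrite rkhs_reproducing rkhs_dot_suml; apply: eq_bigr => p _.
by rewrite rkhs_dotZl rkhs_dot_section.
Qed.

(** Along combinations of sections whose squared distance to [h] tends to its
    infimum, the error becomes orthogonal to every section, as subtracting a
    multiple of the section cannot decrease that distance below the infimum. By
    the reproducing property this is pointwise convergence. *)
Lemma rkhs_fun_lim_section_comb h : exists l : (seq (R * X))^nat,
  forall x, rkhs_fun (section_comb (l n)) x @[n --> \oo] --> rkhs_fun h x.
Proof.
pose E := [set `|h - section_comb l| ^+ 2 | l in [set: seq (R * X)]].
have Elb : has_lbound E by exists 0 => _ [l _ <-]; exact: sqr_ge0.
have Einf : has_inf E by split => //; exists (`|h - section_comb [::]| ^+ 2), [::].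
have adh n : exists l, `|h - section_comb l| ^+ 2 < inf E + n.+1%:R^-1.
  have n0 : 0 < n.+1%:R^-1 :> R by rewrite invr_gt0 ltr0n.
  by have [_ [l _ <-] lt] := inf_adherent n0 Einf; exists l.
have [l lP] := choice adh; exists l => x.
set q : R := k x x + 1.
have q0 : 1 <= q by rewrite /q -rkhs_norm_section lerDr sqr_ge0.
have bound n :
    `|rkhs_fun h x - rkhs_fun (section_comb (l n)) x| ^+ 2 <= q * n.+1%:R^-1.
  set g := h - section_comb (l n); set c := dot g (phi x).
  have -> : rkhs_fun h x - rkhs_fun (section_comb (l n)) x = c.
    by rewrite /c /g rkhs_dotDl rkhs_dotNl -!rkhs_reproducing.
  (* [c / q] minimises the distance when [q] replaces the squared norm of the
     section; adding 1 to the latter avoids a case analysis on its vanishing *)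
  have : inf E <= `|g - (c / q) *: phi x| ^+ 2.
    apply: ge_inf => //; exists ((c / q, x) :: l n) => //.
    by rewrite /section_comb big_cons /= opprD [- _ + _]addrC addrA.
  have := lP n; rewrite -/g rkhs_norm_sqrB -/c rkhs_norm_section.
  rewrite real_normK ?num_real// (_ : k x x = q - 1); last by rewrite /q addrK.
  have -> : 2 * (c / q) * c = 2 * (q^-1 * c ^+ 2) by ring.
  have -> : (c / q) ^+ 2 * (q - 1) = q^-1 * c ^+ 2 - (c / q) ^+ 2 by field; lra.
  have : 0 <= (c / q) ^+ 2 by exact: sqr_ge0.
  move=> lt1 lt2 lt3; rewrite -ler_pdivrMl; last lra.
  move: lt1 lt2 lt3; move: (q^-1 * c ^+ 2) ((c / q) ^+ 2) (`|g| ^+ 2) (n.+1%:R^-1).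
  by move=> a b e f; lra.
apply/cvgrPdist_lt => e e0.
near=> n.
rewrite -(ltr_pXn2r (n := 2)) ?nnegrE// ?ltW//.
rewrite (le_lt_trans (bound n))// -ltr_pdivlMl; last lra.
near: n; apply: near_infty_natSinv_lt (PosNum _).
by rewrite mulr_gt0 ?exprn_gt0// invr_gt0; lra.
Unshelve. all: by end_near. Qed.

End rkhs_theory.

(** * Means of bounded measurable functions, and lower integrals *)

Section bounded_measurable.
Context {R : realType} {d} {T : measurableType d}.
Implicit Types f g : T -> R.

Definition bounded_measurable f :=
  measurable_fun setT f /\ exists M, forall x, `|f x| <= M.

Lemma bounded_measurable_cst a : bounded_measurable (fun=> a).
Proof. by split => //; exists `|a|. Qed.

Lemma bounded_measurableD f g : bounded_measurable f -> bounded_measurable g ->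
  bounded_measurable (fun x => f x + g x).
Proof.
move=> [mf [M fM]] [mg [N gN]]; split; first exact: measurable_funD.
by exists (M + N) => x; rewrite (le_trans (ler_normD _ _))// lerD.
Qed.

Lemma bounded_measurableM f g : bounded_measurable f -> bounded_measurable g ->
  bounded_measurable (fun x => f x * g x).
Proof.
move=> [mf [M fM]] [mg [N gN]]; split; first exact: measurable_funM.
by exists (M * N) => x; rewrite normrM ler_pM.
Qed.

Lemma bounded_measurableZ a f : bounded_measurable f ->
  bounded_measurable (fun x => a * f x).
Proof. exact/bounded_measurableM/bounded_measurable_cst. Qed.

Lemma bounded_measurable_sum (I : Type) (s : seq I) (F : I -> T -> R) :
  (forall i, bounded_measurable (F i)) ->
  bounded_measurable (fun x => \sum_(i <- s) F i x).
Proof.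
move=> bF; elim: s => [|i s IHs].
  rewrite (_ : (fun _ => _) = fun=> 0); first exact: bounded_measurable_cst.
  by apply/funext => x; rewrite big_nil.
rewrite (_ : (fun _ => _) = fun x => F i x + \sum_(j <- s) F j x).
  exact: bounded_measurableD.
by apply/funext => x; rewrite big_cons.
Qed.

Lemma bounded_measurable_prod (I : Type) (s : seq I) (F : I -> T -> R) :
  (forall i, bounded_measurable (F i)) ->
  bounded_measurable (fun x => \prod_(i <- s) F i x).
Proof.
move=> bF; elim: s => [|i s IHs].
  rewrite (_ : (fun _ => _) = fun=> 1); first exact: bounded_measurable_cst.
  by apply/funext => x; rewrite big_nil.
rewrite (_ : (fun _ => _) = fun x => F i x * \prod_(j <- s) F j x).
  exact: bounded_measurableM.
by apply/funext => x; rewrite big_cons.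
Qed.

Lemma bounded_measurable_expR f : bounded_measurable f ->
  bounded_measurable (fun x => expR (f x)).
Proof.
move=> [mf [M fM]]; split; first exact: measurableT_comp.
exists (expR M) => x; rewrite ger0_norm ?expR_ge0// ler_expR.
exact: le_trans (ler_norm _) (fM x).
Qed.

Lemma bounded_measurable_indic (A : set T) : measurable A ->
  bounded_measurable (\1_A : T -> R).
Proof.
move=> mA; split; first exact: measurable_indic.
by exists 1 => x; rewrite indicE; case: (_ \in _); rewrite ?normr1 ?normr0.
Qed.

Variable P : probability T R.
Local Notation E f := (Rintegral P setT f).

Lemma bounded_measurable_integrable f : bounded_measurable f ->
  P.-integrable setT (EFin \o f).
Proof.
move=> [mf [M fM]]; apply: measurable_bounded_integrable => //.
  by apply: le_lt_trans (ltry 1); exact: probability_le1.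
exists M; split => [|N MN x _]; first exact: num_real.
by apply: le_trans (fM x) _; exact: ltW.
Qed.

Lemma EFin_mean f : bounded_measurable f ->
  (\int[P]_x (f x)%:E = (E f)%:E)%E.
Proof.
move=> /bounded_measurable_integrable iF.
by rewrite /Rintegral fineK//; exact: integrable_fin_num.
Qed.

Lemma mean_cst a : E (fun=> a) = a.
Proof. by rewrite Rintegral_cst//= probability_setT mulr1. Qed.

Lemma meanD f g : bounded_measurable f -> bounded_measurable g ->
  E (fun x => f x + g x) = E f + E g.
Proof.
by move=> bf bg; rewrite RintegralD//; exact: bounded_measurable_integrable.
Qed.

Lemma meanZ a f : bounded_measurable f -> E (fun x => a * f x) = a * E f.
Proof.
by move=> bf; rewrite RintegralZl//; exact: bounded_measurable_integrable.
Qed.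

Lemma mean_sum (I : Type) (s : seq I) (F : I -> T -> R) :
  (forall i, bounded_measurable (F i)) ->
  E (fun x => \sum_(i <- s) F i x) = \sum_(i <- s) E (F i).
Proof.
move=> bF; elim: s => [|i s IHs].
  by rewrite big_nil -[RHS](mean_cst 0); apply: eq_Rintegral => x; rewrite big_nil.
rewrite big_cons -IHs -meanD//; last exact: bounded_measurable_sum.
by apply: eq_Rintegral => x; rewrite big_cons.
Qed.

Lemma ler_mean f g : bounded_measurable f -> bounded_measurable g ->
  (forall x, f x <= g x) -> E f <= E g.
Proof.
by move=> bf bg fg; apply: le_Rintegral => //; exact: bounded_measurable_integrable.
Qed.

Lemma norm_mean_le M f : bounded_measurable f -> (forall x, `|f x| <= M) ->
  `|E f| <= M.
Proof.
move=> bf fM; rewrite -[M]mean_cst ler_norml -mulN1r -meanZ; last first.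
  exact: bounded_measurable_cst.
apply/andP; split; apply: ler_mean => //; try exact: bounded_measurable_cst.
  by move=> x; rewrite mulN1r; have := fM x; rewrite ler_norml => /andP[].
by move=> x; have := fM x; rewrite ler_norml => /andP[].
Qed.

Lemma mean_indic (A : set T) : measurable A -> (E \1_A)%:E = P A.
Proof.
move=> mA; rewrite -EFin_mean; last exact: bounded_measurable_indic.
by rewrite integral_indic// setIT.
Qed.

Lemma mean_expR_le f c : bounded_measurable f -> (forall x y, f x - f y <= c) ->
  E (fun x => expR (f x)) <= expR (E f + 2 * c ^+ 2).
Proof.
move=> bf fc; set m := E f.
have bc := bounded_measurable_cst.
have fm x : `|f x - m| <= c.
  rewrite ler_norml; apply/andP; split.
    have : E f <= E (fun y => f x + c).
      by apply: ler_mean => // y; have := fc y x; lra.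
    by rewrite mean_cst -/m; lra.
  have : E (fun y => f x - c) <= E f.
    by apply: ler_mean => // y; have := fc x y; lra.
  by rewrite mean_cst -/m; lra.
have le x : expR (f x) <= expR m * (f x + (- m + expR (2 * c ^+ 2))).
  rewrite -[f x in X in X <= _](subrKC m) expRD ler_wpM2l ?expR_ge0//.
  apply: (le_trans (expR_le_quadratic _)); rewrite addrA lerD2l ler_expR.
  by rewrite ler_pM2l ?ltr0n// -real_normK ?num_real// ler_pXn2r ?nnegrE//
     (le_trans _ (fm x)).
have bfD : bounded_measurable (fun x => f x + (- m + expR (2 * c ^+ 2))).
  exact: bounded_measurableD.
apply: (le_trans (ler_mean _ _ le)).
- exact: bounded_measurable_expR.
- exact: bounded_measurableZ.
by rewrite meanZ// meanD// mean_cst -/m addrA subrr add0r expRD.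
Qed.

Lemma probability_le_mean (A : set T) g : measurable A -> bounded_measurable g ->
  (forall x, 0 <= g x) -> (forall x, A x -> 1 <= g x) -> (P A <= (E g)%:E)%E.
Proof.
move=> mA bg g0 g1; rewrite -mean_indic// lee_fin; apply: ler_mean => //.
  exact: bounded_measurable_indic.
move=> x; rewrite indicE.
by have [/set_mem /g1|_] := boolP (x \in A).
Qed.

End bounded_measurable.

Lemma bounded_measurable_comp (R : realType) d d' (T : measurableType d)
    (S : measurableType d') (h : S -> T) (f : T -> R) :
  measurable_fun setT h -> bounded_measurable f -> bounded_measurable (f \o h).
Proof.
move=> mh [mf [M fM]]; split; first exact: measurableT_comp.
by exists M => x; exact: fM.
Qed.

Section lower_integral.
Context {R : realType} {d} {T : measurableType d}.
Variable mu : {measure set T -> \bar R}.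
Local Open Scope ereal_scope.
Implicit Types f g : T -> \bar R.
Import HBNNSimple.

(** The integral of a nonnegative function is the supremum of the integrals of
    the simple functions below it, which makes it monotone, and superadditive in
    the next lemma, without any measurability. *)
Lemma ge0_le_lower_integral f g : (forall x, 0 <= f x) ->
  (forall x, f x <= g x) -> \int[mu]_x f x <= \int[mu]_x g x.
Proof.
move=> f0 fg; have g0 x : 0 <= g x := le_trans (f0 x) (fg x).
rewrite !ge0_integralTE//; apply: ereal_sup_le => _ [h hf <-]; exists h => //= x.
exact: le_trans (hf x) (fg x).
Qed.

Lemma ge0_lower_integralD f g : (forall x, 0 <= f x) -> (forall x, 0 <= g x) ->
  \int[mu]_x f x + \int[mu]_x g x <= \int[mu]_x (f x + g x).
Proof.
move=> f0 g0.
have fg0 x : 0 <= f x + g x by exact: adde_ge0.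
rewrite !ge0_integralTE//.
set F := ereal_sup _; set G := ereal_sup _.
set S := ereal_sup _.
have sint_ge0 (h : {nnsfun T >-> R}) : 0 <= sintegral mu h by exact: sintegral_ge0.
have le (h1 h2 : {nnsfun T >-> R}) :
    (forall x, (h1 x)%:E <= f x) -> (forall x, (h2 x)%:E <= g x) ->
    sintegral mu h1 + sintegral mu h2 <= S.
  move=> h1f h2g; apply: ereal_sup_ubound; exists (add_nnsfun h1 h2).
    by move=> x /=; rewrite EFinD leeD.
  by rewrite sintegralD.
have FS : F <= S.
  apply: ge_ereal_sup => _ [h hf <-]; rewrite -[leLHS]adde0.
  by rewrite (le_trans _ (le h nnsfun0 hf g0))// sintegral0 adde0.
have GS : G <= S.
  apply: ge_ereal_sup => _ [h hf <-]; rewrite -[leLHS]add0e.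
  by rewrite (le_trans _ (le nnsfun0 h f0 hf))// sintegral0 add0e.
have [->|Soo] := eqVneq S +oo; first exact: leey.
have {}Soo : S < +oo by rewrite ltey.
have G0 : 0 <= G.
  by apply: ereal_sup_ubound; exists nnsfun0; [exact: g0|exact: sintegral0].
have Gfin : G \is a fin_num by rewrite ge0_fin_numE// (le_lt_trans GS).
rewrite -leeBrDr//; apply: ge_ereal_sup => _ [h1 h1f <-].
have h1fin : sintegral mu h1 \is a fin_num.
  rewrite ge0_fin_numE// (le_lt_trans _ Soo)// (le_trans _ FS)//.
  by apply: ereal_sup_ubound; exists h1.
rewrite leeBrDr// addeC -leeBrDr//; apply: ge_ereal_sup => _ [h2 h2g <-].
by rewrite leeBrDr// addeC; exact: le.
Qed.

Lemma ge0_lower_integral_sum (I : Type) (s : seq I) (F : I -> T -> \bar R) :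
  (forall i x, 0 <= F i x) ->
  \sum_(i <- s) \int[mu]_x F i x <= \int[mu]_x \sum_(i <- s) F i x.
Proof.
move=> F0; elim: s => [|i s IHs].
  by rewrite big_nil; apply: integral_ge0 => x _; rewrite big_nil.
rewrite big_cons (le_trans (leeD2l _ IHs))//.
apply: (le_trans (ge0_lower_integralD _ _)) => //.
  by move=> x; exact: sume_ge0.
apply: ge0_le_lower_integral => x; last by rewrite big_cons.
by rewrite adde_ge0// sume_ge0.
Qed.

End lower_integral.

(** * Products of probabilities *)

Section product_probability_theory.
Context {R : realType} {I : finType} {disp : I -> measure_display}.
Context {T : forall i, measurableType (disp i)}.
Variable mu : forall i, probability (T i) R.
Notation redraws s := (redraw_all mu s).
Implicit Types f : prodspace T -> R.

Lemma bounded_measurable_redraw i f : bounded_measurable f ->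
  bounded_measurable (fun z : T i * prodspace T => f (redraw z)).
Proof.
by move=> bf; apply: (bounded_measurable_comp _ bf); exact: measurable_redraw.
Qed.

Lemma bounded_measurable_redraw1 i f (x : prodspace T) : bounded_measurable f ->
  bounded_measurable (fun y : T i => f (redraw (y, x))).
Proof.
move=> /(@bounded_measurable_redraw i) bf.
by apply: (bounded_measurable_comp _ bf); exact: measurable_pair2.
Qed.

Lemma bounded_measurable_redraw_mean i f : bounded_measurable f ->
  bounded_measurable (fun x => \int[mu i]_y f (redraw (y, x))).
Proof.
move=> bf; have bf' := bounded_measurable_redraw i bf; split; last first.
  have [_ [M fM]] := bf; exists M => x.
  by apply: norm_mean_le => //; exact: bounded_measurable_redraw1 bf.
have mF := measurable_fubini_G
  (bounded_measurable_integrable (mu i \x redraws [::])%E bf').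
exact: (measurableT_comp (@fine_measurable _ _ measurableT) mF).
Qed.

Lemma mean_redraw_all i s f : bounded_measurable f ->
  \int[redraws (i :: s)]_x f x =
  \int[redraws s]_x \int[mu i]_y f (redraw (y, x)).
Proof.
move=> bf; have bf' := bounded_measurable_redraw i bf.
have iF := bounded_measurable_integrable (mu i \x redraws s)%E bf'.
rewrite /Rintegral; congr fine.
rewrite integral_distribution//=.
- rewrite -integral21_prod_meas1/=; last exact: iF.
  apply: eq_integral => x _; rewrite -EFin_mean//.
  exact: bounded_measurable_redraw1 bf.
- have [mf _] := bf; exact/measurable_EFinP.
Qed.

(** McDiarmid's inequality, for exponential moments. The law redraws the
    coordinates one after the other, so each coordinate is integrated out in turn
    at the cost of a factor [expR (2 * c ^ 2)], and the partial means still
    have differences bounded by [c]. *)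
Lemma mean_expR_redraw_all_le (c : R) f s : bounded_measurable f -> 0 <= c ->
  (forall i x (y y' : T i), f (redraw (y, x)) - f (redraw (y', x)) <= c) ->
  \int[redraws s]_x expR (f x) <=
  expR (\int[redraws s]_x f x + (2 * c ^+ 2) *+ size s).
Proof.
move=> + c0; set v := 2 * c ^+ 2.
elim: s f => [|i s IHs] f bf fc.
  rewrite /Rintegral /= !integral_dirac//; first by rewrite !diracT !mul1e addr0.
  - have [mf _] := bf; exact/measurable_EFinP.
  - have [mf _] := bounded_measurable_expR bf; exact/measurable_EFinP.
rewrite !mean_redraw_all//; last exact: bounded_measurable_expR.
set A := fun x => \int[mu i]_y f (redraw (y, x)).
have bA : bounded_measurable A by exact: bounded_measurable_redraw_mean.
have step x : \int[mu i]_y expR (f (redraw (y, x))) <= expR v * expR (A x).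
  rewrite -expRD addrC; apply: mean_expR_le => //.
  exact: bounded_measurable_redraw1 bf.
apply: (le_trans (ler_mean _ _ _ step)).
- exact: (@bounded_measurable_redraw_mean i _ (bounded_measurable_expR bf)).
- exact/bounded_measurableZ/bounded_measurable_expR.
rewrite meanZ; last exact: bounded_measurable_expR.
rewrite mulrS addrCA expRD ler_wpM2l ?expR_ge0//; apply: IHs => //.
move=> j x y y'; rewrite /A.
rewrite lerBlDr -[X in X + _](mean_cst (mu i)) -meanD; last 2 first.
- exact: bounded_measurable_cst.
- exact: bounded_measurable_redraw1 bf.
apply: ler_mean.
- exact: bounded_measurable_redraw1 bf.
- apply: bounded_measurableD; first exact: bounded_measurable_cst.
  exact: bounded_measurable_redraw1 bf.
move=> w; rewrite -lerBlDr; have [ij|ij] := eqVneq i j.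
  subst j; have E (z : T i) : redraw (w, redraw (z, x)) = redraw (w, x).
    apply: functional_extensionality_dep => k; rewrite /redraw /=.
    have [<-|ik] := eqVneq i k; first by rewrite !dfwithin.
    by rewrite !dfwithout.
  by rewrite !E subrr.
have E (z : T j) : redraw (w, redraw (z, x)) = redraw (z, redraw (w, x)).
  apply: functional_extensionality_dep => k; rewrite /redraw /=.
  have [ik|ik] := eqVneq i k.
    by subst k; rewrite dfwithin dfwithout 1?eq_sym// dfwithin.
  rewrite dfwithout//; have [jk|jk] := eqVneq j k.
    by subst k; rewrite !dfwithin.
  by rewrite !dfwithout.
by rewrite !E; exact: fc.
Qed.

Lemma mean_prod_redraw_all (F : forall i, T i -> R) s : uniq s ->
  (forall i, bounded_measurable (F i)) ->
  \int[redraws s]_x \prod_(i <- s) F i (x i) = \prod_(i <- s) \int[mu i]_y F i y.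
Proof.
move=> + bF; elim: s => [_|i s IHs /= /andP[si us]].
  rewrite big_nil -[RHS](mean_cst (redraws [::])).
  by apply: eq_Rintegral => x _; rewrite big_nil.
have bFc j : bounded_measurable (fun x : prodspace T => F j (x j)).
  by apply: (bounded_measurable_comp _ (bF j)); exact: measurable_pcoord.
have bP r : bounded_measurable (fun x : prodspace T => \prod_(j <- r) F j (x j)).
  exact: bounded_measurable_prod.
rewrite mean_redraw_all// big_cons -IHs// -meanZ//; apply: eq_Rintegral => x _.
rewrite mulrC -meanZ//; apply: eq_Rintegral => y _.
rewrite big_cons /redraw /= dfwithin mulrC; congr (_ * _).
apply: eq_big_seq => j sj; rewrite dfwithout//.
by apply: contraNneq si => ->.
Qed.

(** The boxes form a family stable by intersection that generates the
    sigma-algebra, so they determine a measure. *)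
Lemma eq_prod_prob (m : {measure set (prodspace T) -> \bar R}) :
  (forall A : forall i, set (T i), (forall i, measurable (A i)) ->
    m [set x | forall i, A i (x i)] = (\prod_i mu i (A i))%E) ->
  forall B, measurable B -> m B = prod_prob mu B.
Proof.
move=> mE; pose box (A : forall i, set (T i)) : set (prodspace T) :=
  [set x | forall i, A i (x i)].
pose G : set (set (prodspace T)) :=
  [set box A | A in [set A | forall i, measurable (A i)]].
have mbox (A : forall i, set (T i)) :
    (forall i, measurable (A i)) -> measurable (box A).
  move=> mA; rewrite (_ : box A =
    [set x : prodspace T | forall i, i \in enum I -> A i (x i)]).
    exact: measurable_box.
  apply/seteqP; split => x xA i; first by move=> _; exact: xA.
  by apply: xA; rewrite mem_enum.
have boxT : box (fun=> setT) = setT by apply/seteqP; split.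
apply: (measure_unique G (fun=> setT)) => //.
- apply/seteqP; split => [B mB|]; last first.
    by apply: smallest_sub => [|_ [A mA <-]];
      [exact: sigma_algebra_measurable|exact: mbox].
  move: B mB; apply: smallest_sub; first exact: smallest_sigma_algebra.
  move=> _ [i _ [A mA <-]]; apply: sub_sigma_algebra.
  exists (dfwith (fun=> setT) i A).
    move=> j; have [<-|ij] := eqVneq i j; first by rewrite dfwithin.
    by rewrite dfwithout.
  rewrite setTI; apply/seteqP; split => x /=; first by move=> /(_ i); rewrite dfwithin.
  move=> xA j; have [<-|ij] := eqVneq i j; first by rewrite dfwithin.
  by rewrite dfwithout.
- move=> _ _ [A mA <-] [B mB <-]; exists (fun i => A i `&` B i).
    by move=> i; exact: measurableI.
  apply/seteqP; split => x /=; first by move=> xAB; split=> i; have [] := xAB i.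
  by move=> [xA xB] i; split; [exact: xA|exact: xB].
- by move=> _; exists (fun=> setT).
- exact: bigcup_const.
- by move=> _ [A mA <-]; rewrite /box mE//; exact/esym/prod_prob_box.
- have := mE (fun=> setT) (fun=> measurableT).
  rewrite (_ : [set _ | _] = setT); last exact: boxT.
  move=> mT _; rewrite mT; rewrite big1 ?ltry// => i _.
  exact: probability_setT.
Qed.

End product_probability_theory.

(** * Laws of coordinates, and the Laplace law *)

Section laws.
Context {R : realType}.

Lemma mean_pcoord (I : finType) d (T : measurableType d) (P : probability T R)
    (i : I) (f : T -> R) : bounded_measurable f ->
  \int[prod_prob (fun _ : I => P)]_x f (x i) = \int[P]_y f y.
Proof.
move=> bf; pose F (j : I) (y : T) := if j == i then f y else 1.
have bF j : bounded_measurable (F j).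
  by rewrite /F; case: (j == i) => //; exact: bounded_measurable_cst.
have := mean_prod_redraw_all (fun _ : I => P) (enum_uniq I) bF.
rewrite big_enum /= (bigD1 i)//= big1 ?mulr1; last first.
  move=> j /negbTE ji; rewrite -[RHS](mean_cst P); apply: eq_Rintegral => y _.
  by rewrite /F ji.
rewrite [X in _ = X -> _](_ : _ = \int[P]_y f y); last first.
  by apply: eq_Rintegral => y _; rewrite /F eqxx.
move=> <-; apply: eq_Rintegral => x _.
rewrite big_enum /= (bigD1 i)//= big1 ?mulr1; first by rewrite /F eqxx.
by move=> j /negbTE ji; rewrite /F ji.
Qed.

(** When [s] is injective, the components of the tuple come from distinct,
    hence independent, observations, so the tuple follows the product of the
    marginals. It is enough to check this on boxes. *)
Lemma mean_shuffled_coord (I J : finType) (disp : J -> measure_display)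
    (T : forall j, measurableType (disp j)) (P : probability (prodspace T) R)
    (s : J -> I) (f : prodspace T -> R) :
  injective s -> bounded_measurable f ->
  \int[prod_prob (fun _ : I => P)]_x f (fun j => x (s j) j) =
  \int[prod_prob (fun j => distribution P (@pcoord _ _ T j))]_y f y.
Proof.
move=> s_inj bf.
pose h (x : prodspace (fun _ : I => prodspace T)) : prodspace T :=
  fun j => x (s j) j.
have mh : measurable_fun setT h.
  apply: measurable_fun_prodspace => j.
  have m1 := @measurable_pcoord _ _ T j.
  have m2 := @measurable_pcoord _ _ (fun _ : I => prodspace T) (s j).
  exact: (measurableT_comp m1 m2).
have mh_mixin := isMeasurableFun.Build _ _ _ _ h mh.
pose hm : {mfun _ >-> _} := HB.pack h mh_mixin.
have [mf _] := bf.
have mEf : measurable_fun setT (EFin \o f) by exact/measurable_EFinP.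
have iF := bounded_measurable_integrable (prod_prob (fun _ : I => P))
  (bounded_measurable_comp mh bf).
rewrite /Rintegral; congr fine.
have := @integral_distribution _ _ _ _ R (prod_prob (fun _ : I => P)) hm
  (EFin \o f) mEf iF.
move=> /= <-; apply: eq_measure_integral => A mA _; apply: eq_prod_prob => //.
move=> B mB; rewrite /distribution /= /pushforward /=.
pose C i : set (prodspace T) :=
  [set y | forall j, j \in enum J -> s j = i -> B j (y j)].
have mC i : measurable (C i).
  have -> : C i = [set y : prodspace T |
      forall j, j \in [seq j <- enum J | s j == i] -> B j (y j)].
    apply/seteqP; split=> y /= yB j.
      by rewrite mem_filter => /andP[/eqP sj jJ]; exact: yB.
    by move=> jJ sj; apply: yB; rewrite mem_filter sj eqxx.
  exact: measurable_box.
transitivity (prod_prob (fun _ : I => P)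
    [set x : prodspace (fun _ : I => prodspace T) | forall i, C i (x i)]).
  apply: (congr1 (prod_prob (fun _ : I => P))); apply/seteqP; split=> x /= xB.
    by move=> i j _ <-; exact: xB.
  by move=> j; apply: (xB (s j) j) => //; rewrite mem_enum.
rewrite prod_prob_box// (partition_big s xpredT)//=; apply: eq_bigr => i _.
have [/existsP[j /eqP sj]|Ni] := boolP [exists j, s j == i].
  rewrite (big_pred1 j); last first.
    by move=> l; apply/eqP/eqP => [sl|->//]; apply: s_inj; rewrite sj.
  rewrite /distribution /= /pushforward; apply: (congr1 P).
  apply/seteqP; split => y /= yB.
    by apply: yB => //; rewrite mem_enum.
  by move=> l _ sl; have -> : l = j by apply: s_inj; rewrite sj.
rewrite big_pred0; last first.
  by move=> j; apply: contraNF Ni => sj; apply/existsP; exists j.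
rewrite (_ : C i = setT); first exact: probability_setT.
apply/seteqP; split=> // y _ j _ sj; exfalso; move/negP: Ni; apply.
by apply/existsP; exists j; rewrite sj.
Qed.

End laws.

Section laplace_tail.
Context {R : realType}.

Definition large_noise (s : R) : set R := [set z | s <= `|z|].

Lemma indic_large_noise s z : \1_(large_noise s) z = (s <= `|z|)%R%:R :> R.
Proof.
rewrite indicE; congr (_%:R); apply: congr1.
by apply/idP/idP => [/set_mem|/mem_set].
Qed.

Lemma measurable_large_noise s : measurable (large_noise s).
Proof.
have := @normr_measurable R setT measurableT `[s, +oo[%classic (measurable_itv _).
rewrite setTI; congr measurable; apply/seteqP; split => x /=;
by rewrite in_itv/= andbT.
Qed.

(** Markov's inequality for [expR (`|x| / 2)], whose mean is twice the total
    mass of an exponential law of rate [1 / 2]. *)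
Lemma laplace_prob_tail (s : R) :
  (@laplace_prob R (large_noise s) <= (2 * expR (- (s / 2)))%:E)%E.
Proof.
have h0 : 0 < (2^-1 : R) by lra.
pose g (x : R) : R := 2^-1 * expR (- (2^-1 * `|x|)).
have g0 x : 0 <= g x by rewrite mulr_ge0// expR_ge0.
have cg : continuous g.
  move=> x; apply: (@continuousM R R^o (fun=> 2^-1) (fun x => expR (- (2^-1 * `|x|)))).
    exact: cst_continuous.
  apply: continuous_comp; last exact: continuous_expR.
  apply: (@continuousN _ R^o); apply: (@continuousM R R^o (fun=> 2^-1) Num.norm).
    exact: cst_continuous.
  exact: norm_continuous.
have mg : measurable_fun setT g by exact: continuous_measurable_fun.
have intg : (\int[lebesgue_measure]_x (g x)%:E = 2%:E)%E.
  rewrite ge0_symfun_integralT//; last by move=> x; rewrite /g /= normrN.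
  rewrite (_ : [set x | _] = `[0%R, +oo[%classic); last first.
    by apply/seteqP; split => x/=; rewrite in_itv/= andbT.
  rewrite -[RHS]mule1 -(integral_exponential_pdf h0).
  congr (_ * _)%E; rewrite integral_mkcond; apply: eq_integral => x _.
  rewrite /exponential_pdf !patchE; case: ifPn => //.
  rewrite ?inE/= in_itv/= andbT => x0.
  by rewrite /g ger0_norm// mulNr.
have mV := measurable_large_noise s.
rewrite /laplace_prob (@le_trans _ _ (\int[lebesgue_measure]_(x in large_noise s)
    ((expR (- (s / 2)))%:E * (g x)%:E))%E)//.
  apply: ge0_le_integral => //.
  - by move=> x _; rewrite lee_fin laplace_pdf_ge0.
  - apply: measurable_funTS; apply/measurable_EFinP.
    exact: measurable_laplace_pdf.
  - by apply: measurable_funTS; apply/measurable_EFinP; exact: measurable_funM.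
  - rewrite /large_noise => x /= sx.
    rewrite -EFinM lee_fin /laplace_pdf /g mulrCA ler_wpM2l//.
    by rewrite -expRD ler_expR; lra.
rewrite (@le_trans _ _ (\int[lebesgue_measure]_x
    ((expR (- (s / 2)))%:E * (g x)%:E))%E)//.
  apply: ge0_subset_integral => //.
  - by apply/measurable_EFinP; exact: measurable_funM.
  - by move=> x _; rewrite -EFinM lee_fin mulr_ge0// expR_ge0.
rewrite ge0_integralZl//.
- by rewrite intg -EFinM mulrC.
- exact/measurable_EFinP.
- by move=> x _; rewrite lee_fin.
Qed.

End laplace_tail.

(** * Moments of uniform permutations and index tuples *)

Section average_laws.
Context {R : realType}.

Lemma avg_indicator_eq (T : finType) (a : T) :
  avg (fun x => (x == a)%:R : R) = #|T|%:R^-1.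
Proof.
rewrite /avg (bigD1 a)//= eqxx big1 ?addr0 ?mulr1// => x /negbTE xa.
by rewrite xa.
Qed.

Lemma avg_coord (I T : finType) (j : I) (g : T -> R) : (0 < #|T|)%N ->
  avg (fun p : {ffun I -> T} => g (p j)) = avg g.
Proof.
move=> T0; rewrite (avg_redraw j) -[RHS](@avg_cst R {ffun I -> T}); last first.
  by rewrite card_ffun expn_gt0 T0.
by apply: eq_avg => p; apply: eq_avg => u; rewrite ffunE eqxx.
Qed.

Lemma avg_collision (I T : finType) (i j : I) : i != j -> (0 < #|T|)%N ->
  avg (fun p : {ffun I -> T} => (p i == p j)%:R : R) = #|T|%:R^-1.
Proof.
move=> ij T0; rewrite (avg_redraw i) -[RHS](@avg_cst R {ffun I -> T}); last first.
  by rewrite card_ffun expn_gt0 T0.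
apply: eq_avg => p; rewrite -(avg_indicator_eq (p j)); apply: eq_avg => u.
by rewrite !ffunE eqxx [j == i]eq_sym (negbTE ij).
Qed.

Lemma avg_prod (I T : finType) (G : I -> T -> R) :
  avg (fun p : {ffun I -> T} => \prod_i G i (p i)) = \prod_i avg (G i).
Proof.
rewrite /avg big_split /= prodr_const card_ffun natrX exprVn; congr (_ * _).
by rewrite bigA_distr_bigA.
Qed.

Lemma avg_perm1 (T : finType) (i : T) (g : T -> R) :
  avg (fun p : {perm T} => g (p i)) = avg g.
Proof.
have T0 : (0 < #|T|)%N by apply/card_gt0P; exists i.
have P0 : (0 < #|{: {perm T}}|)%N by apply/card_gt0P; exists 1%g.
transitivity (avg (fun p : {perm T} => avg (fun u => g (p u)))).
  rewrite (avg_swap (fun u (p : {perm T}) => g (p u))) -[LHS](avg_cst T0).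
  apply: eq_avg => u.
  rewrite -[LHS](avg_bij _ (mulgI (tperm i u))).
  by apply: eq_avg => p /=; rewrite permM tpermL.
rewrite -[RHS](avg_cst P0); apply: eq_avg => p.
exact: (avg_bij g (@perm_inj _ p)).
Qed.

(** The pair of values at two distinct points is uniform off the diagonal, so
    its mean is the mean over all pairs corrected by the diagonal. *)
Lemma avg_perm2 (T : finType) (i l : T) (g : T -> T -> R) : i != l ->
  (#|T|%:R - 1) * avg (fun p : {perm T} => g (p i) (p l)) =
  #|T|%:R * avg (fun a => avg (g a)) - avg (fun a => g a a).
Proof.
move=> il.
have T0 : (0 < #|T|)%N by apply/card_gt0P; exists i.
have nT : #|T|%:R != 0 :> R by rewrite pnatr_eq0 -lt0n.
set O := avg (fun p : {perm T} => g (p i) (p l)).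
have E : (#|T|%:R - 1) * O =
    \sum_(u | u != i) avg (fun p : {perm T} => g (p i) (p u)).
  transitivity (\sum_(u : T | u != i) O).
    rewrite sumr_const -[RHS]mulr_natl; congr (_ * _).
    by rewrite cardC1 -subn1 natrB.
  apply: eq_bigr => u ui; rewrite /O -[LHS](avg_bij _ (mulgI (tperm l u))).
  apply: eq_avg => p /=; rewrite !permM tpermL tpermD//.
  by rewrite eq_sym.
have F : \sum_u avg (fun p : {perm T} => g (p i) (p u)) =
    #|T|%:R * avg (fun a => avg (g a)).
  rewrite -avg_sum -(avg_perm1 i (fun a => avg (g a))) -avgZ; apply: eq_avg => p.
  rewrite -[in RHS](avg_bij (g (p i)) (@perm_inj _ p)) mulVKf//.
have D : avg (fun p : {perm T} => g (p i) (p i)) = avg (fun a => g a a).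
  exact: (avg_perm1 i (fun a => g a a)).
by rewrite E -F [in RHS](bigD1 i)//= D addrAC subrr add0r.
Qed.

(** Under the hypothesis on [g], which holds for positive semi-definite kernels,
    the diagonal has the larger mean, and excluding it lowers the mean. *)
Lemma avg_perm2_le (T : finType) (i l : T) (g : T -> T -> R) : i != l ->
  (forall a b, g a b + g b a <= g a a + g b b) ->
  avg (fun p : {perm T} => g (p i) (p l)) <= avg (fun a => avg (g a)).
Proof.
move=> il gd.
have T0 : (0 < #|T|)%N by apply/card_gt0P; exists i.
have T1 : 0 < #|T|%:R - 1 :> R.
  rewrite subr_gt0 ltr1n; have := max_card (mem [set i; l]%SET).
  by rewrite cards2 il.
have E := avg_perm2 g il.
have SD : avg (fun a => avg (g a)) <= avg (fun a => g a a).
  have : avg (fun a => avg (fun b => g a b + g b a)) <=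
         avg (fun a => avg (fun b => g a a + g b b)).
    by apply: ler_avg => a; apply: ler_avg => b; exact: gd.
  have -> : avg (fun a => avg (fun b => g a b + g b a)) =
            avg (fun a => avg (g a)) + avg (fun a => avg (g a)).
    rewrite (eq_avg (G := fun a => avg (g a) + avg (g ^~ a))).
      by rewrite avgD avg_swap.
    by move=> a; rewrite avgD.
  have -> : avg (fun a => avg (fun b => g a a + g b b)) =
            avg (fun a => g a a) + avg (fun a => g a a).
    rewrite (eq_avg (G := fun a => g a a + avg (fun b => g b b))).
      by rewrite avgD (avg_cst T0).
    by move=> a; rewrite avgD (avg_cst T0).
  by lra.
by rewrite -(ler_pM2l T1) E; lra.
Qed.

End average_laws.

(** * The empirical gap of a function *)

Section hilbert_average.
Context {R : realType} {X : Type} {k : X -> X -> R} (H : rkhs k).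

Definition havg (T : finType) (F : T -> H) : H := #|T|%:R^-1 *: \sum_x F x.

Lemma rkhs_dot_havgl (T : finType) (F : T -> H) g :
  rkhs_dot H (havg F) g = avg (fun x => rkhs_dot H (F x) g).
Proof. by rewrite rkhs_dotZl rkhs_dot_suml. Qed.

Lemma rkhs_dot_havg (S T : finType) (F : S -> H) (G : T -> H) :
  rkhs_dot H (havg F) (havg G) =
  avg (fun x => avg (fun y => rkhs_dot H (F x) (G y))).
Proof.
rewrite rkhs_dot_havgl; apply: eq_avg => x; rewrite rkhs_dotC rkhs_dot_havgl.
by apply: eq_avg => y; rewrite rkhs_dotC.
Qed.

End hilbert_average.

Section empirical_gap.
Context {R : realType} {d : nat} {X : 'I_d -> ptopologicalType} {n : nat}.
Hypothesis n0 : (0 < n)%N.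
Implicit Types (f : obs X -> R) (x : 'I_n -> obs X).

Let I0 : (0 < #|{: 'I_n}|)%N. Proof. by rewrite card_ord. Qed.
Let S0 : (0 < #|{: {ffun 'I_d -> 'I_n}}|)%N.
Proof. by rewrite card_ffun card_ord expn_gt0 n0. Qed.

Definition select x (s : {ffun 'I_d -> 'I_n}) : obs X := fun j => x (s j) j.

Definition gap f x : R := avg (fun i => f (x i)) - avg (fun s => f (select x s)).

Lemma select_permute_sample x (p : {ffun 'I_d -> 'S_n}) s :
  select (permute_sample p x) s = select x [ffun j => p j (s j)].
Proof.
by apply: functional_extensionality_dep => j; rewrite /select ffunE.
Qed.

Lemma permute_sampleE x (p : {ffun 'I_d -> 'S_n}) i :
  permute_sample p x i = select x [ffun j => p j i].
Proof.
by apply: functional_extensionality_dep => j; rewrite /select ffunE.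
Qed.

(** Each component is permuted as a whole, which leaves its empirical law
    unchanged. *)
Lemma avg_select_permute f x (p : {ffun 'I_d -> 'S_n}) :
  avg (fun s => f (select (permute_sample p x) s)) = avg (fun s => f (select x s)).
Proof.
pose h (s : {ffun 'I_d -> 'I_n}) := [ffun j => p j (s j)].
have h_inj : injective h.
  move=> s t /ffunP st; apply/ffunP => j; have := st j.
  by rewrite !ffunE => /perm_inj.
rewrite -[RHS](avg_bij _ h_inj); apply: eq_avg => s /=.
by rewrite select_permute_sample.
Qed.

Lemma permute_sample1 x : permute_sample [ffun=> 1%g] x = x.
Proof.
apply/funext => i; apply: functional_extensionality_dep => j.
by rewrite /permute_sample ffunE perm1.
Qed.

Variable (M : R).
Hypothesis M0 : 0 <= M.

Lemma norm_avg_le (T : finType) (F : T -> R) : (0 < #|T|)%N ->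
  (forall t, `|F t| <= M) -> `|avg F| <= M.
Proof.
move=> T0 FM; rewrite ler_norml -{1}(avg_cst T0 M) -avgN.
apply/andP; split; last rewrite -(avg_cst T0 M); apply: ler_avg => t;
by have := FM t; rewrite ler_norml => /andP[].
Qed.

Lemma norm_gap_le f x : (forall y, `|f y| <= M) -> `|gap f x| <= M + M.
Proof.
by move=> fM; rewrite (le_trans (ler_normB _ _))// lerD// norm_avg_le.
Qed.

(** Only the first average of the gap sees the transposition, and only through
    the two observations whose indices are exchanged. *)
Lemma gap_permute_transposition f x (p : {ffun 'I_d -> 'S_n}) j a b (q : 'S_n) :
  (forall y, `|f y| <= M) ->
  gap f (permute_sample (set_coord p j (tperm a b * q)%g) x) -
  gap f (permute_sample (set_coord p j q) x) <= 4 * M / n%:R.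
Proof.
move=> fM; rewrite /gap !avg_select_permute opprB addrA subrK -avgN -avgD.
set x1 := permute_sample _ x; set x2 := permute_sample _ x.
have E i : i != a -> i != b -> x1 i = x2 i.
  move=> ia ib; apply: functional_extensionality_dep => l.
  rewrite /x1 /x2 /permute_sample !ffunE; case: eqVneq => // _.
  by rewrite permM tpermD// eq_sym.
apply: (@le_trans _ _ (avg (fun i => 2 * M * (i == a)%:R + 2 * M * (i == b)%:R))).
  apply: ler_avg => i.
  have := fM (x1 i); have := fM (x2 i); rewrite !ler_norml.
  have [_|ia] := eqVneq i a; have [_|ib] := eqVneq i b;
    rewrite /= ?mulr1 ?mulr0; try lra.
  by rewrite E// subrr addr0.
by rewrite avgD !avgZ !avg_indicator_eq card_ord; lra.
Qed.

(** One observation enters one term of the first average, and a proportion at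
    most [d / n] of the terms of the second. *)
Lemma gap_redraw f i (x : prodspace (fun _ : 'I_n => obs X)) y y' :
  (forall z, `|f z| <= M) ->
  gap f (redraw (T := fun _ => obs X) (i := i) (y, x)) -
  gap f (redraw (T := fun _ => obs X) (i := i) (y', x)) <=
  2 * M * (d.+1%:R) / n%:R.
Proof.
move=> fM; set x1 := redraw _; set x2 := redraw _.
have E l : l != i -> x1 l = x2 l.
  by move=> li; rewrite /x1 /x2 /redraw /= !dfwithout// eq_sym.
have le1 : avg (fun l => f (x1 l) - f (x2 l)) <= 2 * M / n%:R.
  apply: (@le_trans _ _ (avg (fun l => 2 * M * (l == i)%:R))).
    apply: ler_avg => l; have := fM (x1 l); have := fM (x2 l); rewrite !ler_norml.
    have [_|li] := eqVneq l i; rewrite /= ?mulr1 ?mulr0; first lra.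
    by rewrite E// subrr.
  by rewrite avgZ avg_indicator_eq card_ord.
have le2 : avg (fun s => f (select x2 s) - f (select x1 s)) <= 2 * M * d%:R / n%:R.
  apply: (@le_trans _ _ (avg (fun s : {ffun 'I_d -> 'I_n} =>
      2 * M * \sum_j (s j == i)%:R))).
    apply: ler_avg => s.
    have := fM (select x1 s); have := fM (select x2 s); rewrite !ler_norml.
    have [/existsP[j sj]|/existsPn Ns] := boolP [exists j, s j == i]; last first.
      rewrite (_ : select x2 s = select x1 s); last first.
        by apply: functional_extensionality_dep => j; rewrite /select E.
      by rewrite subrr big1 ?mulr0// => j _; rewrite (negbTE (Ns j)).
    have : (1 : R) <= \sum_j (s j == i)%:R.
      by rewrite (bigD1 j)//= sj lerDl sumr_ge0.
    by move: (\sum_j _) M0 => S; nra.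
  rewrite avgZ avg_sum (eq_bigr (fun=> n%:R^-1)) => [|j _].
    by rewrite sumr_const card_ord -[_ *+ d]mulr_natl mulrA.
  by rewrite (avg_coord j (fun u => (u == i)%:R)) ?avg_indicator_eq card_ord.
rewrite /gap (_ : 2 * M * _ / _ = 2 * M / n%:R + 2 * M * d%:R / n%:R); last first.
  by rewrite -[d.+1%:R]natr1; ring.
by move: le1 le2; rewrite !avgD !avgN; lra.
Qed.

End empirical_gap.

(** * The statistic and its mean under random permutations *)

Lemma continuous_measurable_borel (R : realType) (X : ptopologicalType)
    (g : X -> R) : continuous g -> measurable_fun [set: borel X] g.
Proof.
move=> cg; apply: (measurability _ (RGenOInfty.measurableE R)).
move=> _ [_ [a ->] <-]; rewrite setTI; apply: sub_sigma_algebra.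
apply: open_comp; last exact: interval_open.
by move=> x _; exact: cg.
Qed.

Section kernel_statistics.
Context {R : realType} {d : nat} {X : 'I_d -> ptopologicalType}.
Context {k : forall j, X j -> X j -> R} (H : rkhs (tensor_kernel k)).
Notation phi := (@rkhs_section _ _ _ H).
Variable M : R.
Hypothesis M0 : 0 <= M.
Hypothesis kM : forall x : obs X, tensor_kernel k x x <= M ^+ 2.

Lemma measurable_tensor_kernel (y : obs X) :
  (forall j, continuous_kernel (@k j)) ->
  measurable_fun setT (fun x : obs X => tensor_kernel k x y).
Proof.
move=> kc; apply: measurable_prod => j _.
have mk : measurable_fun [set: borel (X j)] (fun z : X j => @k j z (y j)).
  apply: continuous_measurable_borel => z.
  apply: (@continuous_comp _ _ _ (fun z => (z, y j)) (fun p => @k j p.1 p.2)).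
    by apply: cvg_pair; [exact: cvg_id|exact: cvg_cst].
  exact: kc.
exact: (measurableT_comp mk (@measurable_pcoord _ _ (fun j => borel (X j)) j)).
Qed.

Lemma unit_ball_le f x : unit_ball H f -> `|f x| <= M.
Proof. by move=> [h h1 <-]; exact: rkhs_fun_norm_le. Qed.

Lemma unit_ball_bounded_measurable (f : obs X -> R) :
  (forall j, continuous_kernel (@k j)) -> unit_ball H f -> bounded_measurable f.
Proof.
move=> kc Hf; split; last by exists M => x; exact: unit_ball_le.
have [h _ <-] := Hf; have [l lP] := rkhs_fun_lim_section_comb h.
apply: (@measurable_fun_cvg _ _ _ _ (fun m x => rkhs_fun (section_comb H (l m)) x)).
  move=> m; rewrite (_ : (fun _ => _) =
    fun x => \sum_(p <- l m) p.1 * tensor_kernel k x p.2); last first.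
    by apply/funext => x; exact: rkhs_fun_section_comb.
  elim: (l m) => [|p r IHr].
    rewrite (_ : (fun _ => _) = fun=> 0)//.
    by apply/funext => x; rewrite big_nil.
  rewrite (_ : (fun _ => _) = (fun x : obs X => p.1 * tensor_kernel k x p.2 +
      \sum_(q <- r) q.1 * tensor_kernel k x q.2)); last first.
    by apply/funext => x; rewrite big_cons.
  apply: measurable_funD => //; apply: measurable_funM => //.
  exact: measurable_tensor_kernel.
by move=> x _; exact: lP.
Qed.

Section sample.
Context {n : nat}.
Hypothesis n0 : (0 < n)%N.
Implicit Type x : 'I_n -> obs X.

Let I0 : (0 < #|{: 'I_n}|)%N. Proof. by rewrite card_ord. Qed.

Lemma dHSIC_sampleE x :
  dHSIC_sample H x = sup [set gap f x | f in unit_ball H].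
Proof.
by rewrite /dHSIC_sample /gap /avg card_ffun !card_ord.
Qed.

Lemma gap_le_dHSIC_sample f x : unit_ball H f -> gap f x <= dHSIC_sample H x.
Proof.
move=> Hf; rewrite dHSIC_sampleE; apply: ub_le_sup; last by exists f.
exists (M + M) => _ [g Hg <-]; rewrite (le_trans (ler_norm _))//.
by apply: norm_gap_le => // y; exact: unit_ball_le.
Qed.

Lemma dHSIC_sample_le c x : (forall f, unit_ball H f -> gap f x <= c) ->
  dHSIC_sample H x <= c.
Proof.
move=> fc; rewrite dHSIC_sampleE; apply: ge_sup.
  exists (gap (rkhs_fun (0 : H)) x), (rkhs_fun (0 : H)) => //.
  by exists 0 => //=; rewrite normr0.
by move=> _ [f Hf <-]; exact: fc.
Qed.

Lemma dHSIC_permute_transposition x (p : {ffun 'I_d -> 'S_n}) j a b (q : 'S_n) :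
  dHSIC_sample H (permute_sample (set_coord p j (tperm a b * q)%g) x) -
  dHSIC_sample H (permute_sample (set_coord p j q) x) <= 4 * M / n%:R.
Proof.
rewrite lerBlDr; apply: dHSIC_sample_le => f Hf.
have := gap_permute_transposition x p j a b q (fun y => unit_ball_le y Hf).
by have := gap_le_dHSIC_sample (permute_sample (set_coord p j q) x) Hf; lra.
Qed.

Section centered_embedding.
Hypothesis kp : forall j y z, 0 <= @k j y z.
Hypothesis kd : forall j y z, @k j y z + @k j z y <= @k j y y + @k j z z.
Variable x : 'I_n -> obs X.

Let B := havg (fun s => phi (select x s)).
Let A (p : {ffun 'I_d -> 'S_n}) := havg (fun i => phi (permute_sample p x i)).
Let g j a b := @k j (x b j) (x a j).
Let P := \prod_j avg (fun a => avg (g j a)).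

Let dotg s t : rkhs_dot H (phi (select x s)) (phi (select x t)) =
  \prod_j g j (s j) (t j).
Proof. by rewrite rkhs_dot_section. Qed.

Let dotBB : rkhs_dot H B B = P.
Proof.
rewrite rkhs_dot_havg /P -avg_prod; apply: eq_avg => s.
by rewrite -avg_prod; apply: eq_avg => t; exact: dotg.
Qed.

Let dotAB : avg (fun p => rkhs_dot H (A p) B) = P.
Proof.
rewrite (eq_avg (G := fun p : {ffun 'I_d -> 'S_n} =>
    avg (fun i => \prod_j avg (g j (p j i))))); last first.
  move=> p; rewrite rkhs_dot_havg; apply: eq_avg => i.
  rewrite -avg_prod; apply: eq_avg => t; rewrite permute_sampleE dotg.
  by apply: eq_bigr => j _; rewrite ffunE.
rewrite (avg_swap (fun i (p : {ffun 'I_d -> 'S_n}) => \prod_j avg (g j (p j i)))).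
rewrite -[RHS](avg_cst I0); apply: eq_avg => i.
rewrite (avg_prod (fun j (q : 'S_n) => avg (g j (q i)))); apply: eq_bigr => j _.
exact: (avg_perm1 i (fun a => avg (g j a))).
Qed.

Let P_ge0 : 0 <= P.
Proof.
by apply: prodr_ge0 => j _; apply: avg_ge0 => a; apply: avg_ge0 => b; exact: kp.
Qed.

Let dotAA : avg (fun p => rkhs_dot H (A p) (A p)) <= P + M ^+ 2 / n%:R.
Proof.
rewrite (eq_avg (G := fun p : {ffun 'I_d -> 'S_n} => avg (fun i => avg (fun l =>
    \prod_j g j (p j i) (p j l))))); last first.
  move=> p; rewrite rkhs_dot_havg; apply: eq_avg => i; apply: eq_avg => l.
  rewrite !permute_sampleE dotg.
  by apply: eq_bigr => j _; rewrite !ffunE.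
rewrite (avg_swap (fun i (p : {ffun 'I_d -> 'S_n}) =>
  avg (fun l => \prod_j g j (p j i) (p j l)))).
apply: (@le_trans _ _ (avg (fun i : 'I_n =>
    avg (fun l : 'I_n => P + M ^+ 2 * (l == i)%:R)))).
  apply: ler_avg => i.
  rewrite (avg_swap (fun l (p : {ffun 'I_d -> 'S_n}) =>
    \prod_j g j (p j i) (p j l))).
  apply: ler_avg => l; have [->|li] := eqVneq l i; rewrite ?mulr1 ?mulr0 ?addr0.
    apply: (@le_trans _ _ (M ^+ 2)); last by rewrite lerDr.
    rewrite -[leRHS](@avg_cst R {ffun 'I_d -> 'S_n}); last first.
      by apply/card_gt0P; exists [ffun=> 1%g].
    by apply: ler_avg => p; exact: (kM (fun j => x (p j i) j)).
  rewrite (avg_prod (fun j (q : 'S_n) => g j (q i) (q l))); apply: ler_prod => j _.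
  rewrite avg_ge0/=; last by move=> q; exact: kp.
  apply: avg_perm2_le; first by rewrite eq_sym.
  by move=> a b; rewrite /g addrC; exact: kd.
rewrite (eq_avg (G := fun=> P + M ^+ 2 * n%:R^-1)); last first.
  by move=> i; rewrite avgD avgZ avg_indicator_eq (avg_cst I0) card_ord.
by rewrite (avg_cst I0).
Qed.

(** The permuted statistic is at most the norm of the average of the permuted
    embeddings centred at its mean [B]. In the second moment of this norm, the
    off-diagonal terms contribute at most the squared norm of [B], because two
    points drawn without replacement are on average no more alike than two
    independent ones in each component, and nonnegativity of the kernels lets the
    product over the components inherit this. The diagonal terms are left. *)
Lemma avg_dHSIC_permute_le :
  avg (fun p : {ffun 'I_d -> 'S_n} => dHSIC_sample H (permute_sample p x)) <=
  M / Num.sqrt n%:R.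
Proof.
pose D p := A p - 1 *: B.
apply: (@le_trans _ _ (avg (fun p => `|D p|))).
  apply: ler_avg => p; apply: dHSIC_sample_le => _ [h h1 <-].
  have -> : gap (rkhs_fun h) (permute_sample p x) = rkhs_dot H h (D p).
    rewrite /gap avg_select_permute /D scale1r rkhs_dotC rkhs_dotDl rkhs_dotNl.
    rewrite !rkhs_dot_havgl; congr (_ - _); apply: eq_avg => i;
    by rewrite rkhs_reproducing rkhs_dotC.
  by rewrite (le_trans (rkhs_cauchy_schwarz _ _))// ler_piMl.
have F0 : (0 < #|{: {ffun 'I_d -> 'S_n}}|)%N.
  by apply/card_gt0P; exists [ffun=> 1%g].
rewrite -(ler_pXn2r (n := 2)) ?nnegrE ?divr_ge0 ?sqrtr_ge0//; last first.
  by apply: avg_ge0 => p.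
rewrite (le_trans (le_avg_sqr F0 _))// expr_div_n sqr_sqrtr ?ler0n//.
rewrite (eq_avg (G := fun p => rkhs_dot H (A p) (A p) +
    (- 2 * rkhs_dot H (A p) B + rkhs_dot H B B))); last first.
  by move=> p; rewrite /D rkhs_norm_sqrB !rkhs_normE; ring.
by rewrite !avgD avgZ (avg_cst F0) dotAB dotBB; have := dotAA; lra.
Qed.

End centered_embedding.

End sample.
End kernel_statistics.

(** * Tails of the permuted statistic and of the empirical gap *)

Lemma mean_avg (R : realType) d (T : measurableType d) (P : probability T R)
    (S : finType) (F : S -> T -> R) : (forall s, bounded_measurable (F s)) ->
  \int[P]_x avg (F ^~ x) = avg (fun s => \int[P]_x F s x).
Proof.
by move=> bF; rewrite meanZ ?mean_sum//; exact: bounded_measurable_sum.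
Qed.

Section tails.
Context {R : realType} {d : nat} {X : 'I_d -> ptopologicalType}.
Context {k : forall j, X j -> X j -> R} (H : rkhs (tensor_kernel k)).
Context {n : nat}.
Variable M : R.
Hypotheses (n0 : (0 < n)%N) (M0 : 0 <= M).

Let I0 : (0 < #|{: 'I_n}|)%N. Proof. by rewrite card_ord. Qed.
Let S0 : (0 < #|{: {ffun 'I_d -> 'I_n}}|)%N.
Proof. by rewrite card_ffun card_ord expn_gt0 n0. Qed.
Let N0 : 0 < n%:R :> R. Proof. by rewrite ltr0n. Qed.

Section permutation_tail.
Hypothesis kM : forall x : obs X, tensor_kernel k x x <= M ^+ 2.
Hypothesis kp : forall j y z, 0 <= @k j y z.
Hypothesis kd : forall j y z, @k j y z + @k j z y <= @k j y y + @k j z z.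

Lemma dHSIC_permute_tail (x : 'I_n -> obs X) (lam t : R) : 0 <= lam ->
  avg (fun p : {ffun 'I_d -> 'S_n} =>
    (t <= dHSIC_sample H (permute_sample p x))%R%:R) <=
  expR (- (lam * t) + lam * (M / Num.sqrt n%:R) +
        128 * d%:R * lam ^+ 2 * M ^+ 2 / n%:R).
Proof.
move=> lam0.
pose h (p : {ffun 'I_d -> 'S_n}) : R := dHSIC_sample H (permute_sample p x).
pose c := lam * (4 * M / n%:R).
have c0 : 0 <= c by rewrite !mulr_ge0// invr_ge0 ler0n.
have concentration : avg (fun p => expR (lam * h p)) <=
    expR (avg (fun p => lam * h p) + (2 * (c + c) ^+ 2) *+ #|'I_n| *+ #|'I_d|).
  apply: (avg_expR_ffun_le _
    (nbr := fun p q : 'S_n => exists a b, p = (tperm a b * q)%g) (c := c)) => //.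
  - by apply/card_gt0P; exists 1%g.
  - by move=> g gc; apply: avg_expR_perm_le => // q a b; apply: gc; exists a, b.
  - move=> p j _ q [a [b ->]]; rewrite -mulrBr ler_wpM2l//.
    exact: dHSIC_permute_transposition.
apply: (@le_trans _ _ (avg (fun p => expR (- (lam * t)) * expR (lam * h p)))).
  apply: ler_avg => p; rewrite -expRD.
  have [tp|_] := leP t _; last by rewrite expR_ge0.
  by rewrite -[1%:R]expR0 ler_expR addrC -mulrBr mulr_ge0// subr_ge0.
rewrite avgZ -addrA expRD ler_wpM2l ?expR_ge0//.
apply: (le_trans concentration); rewrite ler_expR avgZ; apply: lerD.
  by rewrite ler_wpM2l//; apply: avg_dHSIC_permute_le.
have E (z : R) : z *+ n *+ d = z * n%:R * d%:R.
  by rewrite -[_ *+ d]mulr_natr -[z *+ n]mulr_natr.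
rewrite !card_ord E /c.
rewrite le_eqVlt; apply/orP; left; apply/eqP; field.
by rewrite gt_eqF.
Qed.

End permutation_tail.

Section sample_tail.
Variable P : probability (obs X) R.
Variable f : obs X -> R.
Hypothesis fM : forall y, `|f y| <= M.
Hypothesis bf : bounded_measurable f.
Notation Pn := (prod_prob (fun _ : 'I_n => P)).
Notation E0 := (\int[P]_y f y).
Notation E1 := (\int[prod_prob (marginal P)]_y f y).

Let bf_coord (i : 'I_n) :
  bounded_measurable (fun x : prodspace (fun _ : 'I_n => obs X) => f (x i)).
Proof.
by apply: (bounded_measurable_comp _ bf); exact: measurable_pcoord.
Qed.

Let bf_select (s : {ffun 'I_d -> 'I_n}) :
  bounded_measurable (fun x : prodspace (fun _ : 'I_n => obs X) => f (select x s)).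
Proof.
apply: (bounded_measurable_comp _ bf); apply: measurable_fun_prodspace => j.
have m1 := @measurable_pcoord _ _ (fun j => borel (X j)) j.
have m2 := @measurable_pcoord _ _ (fun _ : 'I_n => obs X) (s j).
exact: (measurableT_comp m1 m2).
Qed.

Lemma bounded_measurable_gap : bounded_measurable
  (fun x : prodspace (fun _ : 'I_n => obs X) => gap f x).
Proof.
have bA : bounded_measurable (fun x : prodspace (fun _ : 'I_n => obs X) =>
    avg (fun i => f (x i))).
  exact/bounded_measurableZ/bounded_measurable_sum.
have bB : bounded_measurable (fun x : prodspace (fun _ : 'I_n => obs X) =>
    -1 * avg (fun s => f (select x s))).
  exact/bounded_measurableZ/bounded_measurableZ/bounded_measurable_sum.
have := bounded_measurableD bA bB.
by congr bounded_measurable; apply/funext => x; rewrite mulN1r.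
Qed.

(** Tuples of distinct indices contribute the population gap exactly; the others
    form a proportion at most [d ^ 2 / n]. *)
Lemma mean_gap_ge :
  E0 - E1 - 2 * M * d%:R ^+ 2 / n%:R <= \int[Pn]_x gap f x.
Proof.
have meanA : \int[Pn]_x avg (fun i => f (x i)) = E0.
  rewrite (mean_avg Pn bf_coord) (eq_avg (G := fun=> E0)) ?avg_cst// => i.
  exact: (mean_pcoord P i bf).
have meanB : \int[Pn]_x avg (fun s => f (select x s)) =
    avg (fun s : {ffun 'I_d -> 'I_n} => \int[Pn]_x f (select x s)).
  exact: (mean_avg Pn bf_select).
have gapE : \int[Pn]_x gap f x =
    E0 - avg (fun s : {ffun 'I_d -> 'I_n} => \int[Pn]_x f (select x s)).
  rewrite -meanA -meanB -mulN1r -meanZ -?meanD.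
  - by apply: eq_Rintegral => x _; rewrite mulN1r.
  - exact/bounded_measurableZ/bounded_measurable_sum.
  - exact/bounded_measurableZ/bounded_measurableZ/bounded_measurable_sum.
  - exact/bounded_measurableZ/bounded_measurable_sum.
rewrite gapE -addrA lerD2l -opprD lerN2.
pose coll (s : {ffun 'I_d -> 'I_n}) : R := \sum_j \sum_l ((j != l) && (s j == s l))%:R.
apply: (@le_trans _ _ (avg (fun s => E1 + 2 * M * coll s))).
  apply: ler_avg => s.
  have [/injectiveP sI|/injectivePn [j [l jl sjl]]] := boolP (injectiveb s).
    rewrite (mean_shuffled_coord P sI bf) lerDl !mulr_ge0//.
    by apply: sumr_ge0 => j _; apply: sumr_ge0.
  have : 1 <= coll s.
    rewrite /coll (bigD1 j)//= (bigD1 l)//= jl sjl eqxx -addrA lerDl addr_ge0//.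
      by apply: sumr_ge0.
    by apply: sumr_ge0 => i _; apply: sumr_ge0.
  have : `|\int[Pn]_x f (select x s)| <= M by apply: norm_mean_le.
  have : `|E1| <= M by apply: norm_mean_le.
  by rewrite !ler_norml; move: (coll s) M0 => S; nra.
rewrite avgD avgZ (avg_cst S0) lerD2l -[leRHS]mulrA ler_wpM2l ?mulr_ge0//.
rewrite /coll avg_sum (@le_trans _ _ (\sum_(j < d) \sum_(l < d) n%:R^-1))//.
  apply: ler_sum => j _; rewrite avg_sum; apply: ler_sum => l _.
  have [->|jl] := eqVneq j l; first by rewrite (avg_cst S0) invr_ge0 ler0n.
  by rewrite /= avg_collision// card_ord.
rewrite !sumr_const card_ord -[_ *+ d]mulr_natr -[_^-1 *+ d]mulr_natr.
by rewrite le_eqVlt; apply/orP; left; apply/eqP; ring.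
Qed.

Lemma measurable_gap_le c :
  measurable [set x : prodspace (fun _ : 'I_n => obs X) | gap f x <= c].
Proof.
have [mg _] := bounded_measurable_gap.
have := mg measurableT `]-oo, c]%classic (measurable_itv _).
by rewrite setTI; congr measurable; apply/seteqP; split => x /=; rewrite in_itv.
Qed.

Lemma gap_lower_tail (lam t : R) : 0 <= lam ->
  (Pn [set x | (gap f x <= \int[Pn]_x gap f x - t)%R] <=
   (expR (- (lam * t) +
          8 * d.+1%:R ^+ 2 * lam ^+ 2 * M ^+ 2 / n%:R))%:E)%E.
Proof.
move=> lam0; set m := \int[Pn]_x gap f x.
have bg := bounded_measurable_gap.
have bng : bounded_measurable
    (fun x : prodspace (fun _ : 'I_n => obs X) => - lam * gap f x).
  exact: bounded_measurableZ.
have beg := bounded_measurable_expR bng.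
have mA := measurable_gap_le (m - t).
apply: (le_trans (probability_le_mean Pn mA
  (bounded_measurableZ (expR (lam * (m - t))) beg) _ _)).
- by move=> x; rewrite mulr_ge0// expR_ge0.
- move=> x /= xA; rewrite -expRD -[leLHS]expR0 ler_expR mulNr -mulrBr.
  by rewrite mulr_ge0// subr_ge0.
rewrite lee_fin meanZ// (_ : - (lam * t) + _ = lam * (m - t) + (- lam * m +
    8 * d.+1%:R ^+ 2 * lam ^+ 2 * M ^+ 2 / n%:R)); last ring.
rewrite expRD ler_wpM2l ?expR_ge0//.
pose c := lam * (2 * M * d.+1%:R / n%:R).
have c0 : 0 <= c by rewrite !mulr_ge0// invr_ge0 ler0n.
apply: (le_trans (mean_expR_redraw_all_le _ _ bng c0 _)).
  move=> i x y y'; rewrite !mulNr opprK addrC -mulrBr ler_wpM2l//.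
  exact: gap_redraw.
rewrite ler_expR meanZ// lerD2l size_enum_ord /c.
rewrite le_eqVlt; apply/orP; left; apply/eqP.
by rewrite -[_ *+ n]mulr_natr; field; rewrite gt_eqF.
Qed.

End sample_tail.
End tails.

(** * The type II error as an integral *)

Section product_mean.
Context {R : realType} {d1 d2} {T1 : measurableType d1} {T2 : measurableType d2}.
Variables (P : probability T1 R) (Q : probability T2 R).

Lemma mean_fst f : bounded_measurable f ->
  \int[(P \x Q)%E]_z f z.1 = \int[P]_x f x.
Proof.
move=> bf; have bf1 := bounded_measurable_comp (@measurable_fst _ _ T1 T2) bf.
have iF := bounded_measurable_integrable (P \x Q)%E bf1.
rewrite /Rintegral; congr fine.
rewrite -(integral12_prod_meas1 iF); apply: eq_integral => x _.
by rewrite /fubini_F /= integral_cst//= probability_setT mule1.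
Qed.

Lemma mean_snd f : bounded_measurable f ->
  \int[(P \x Q)%E]_z f z.2 = \int[Q]_y f y.
Proof.
move=> bf; have bf1 := bounded_measurable_comp (@measurable_snd _ _ T1 T2) bf.
have iF := bounded_measurable_integrable (P \x Q)%E bf1.
rewrite /Rintegral; congr fine.
rewrite -(integral21_prod_meas1 iF); apply: eq_integral => y _.
by rewrite /fubini_G /= integral_cst//= probability_setT mule1.
Qed.

End product_mean.

Section test_error.
Context {R : realType} {d : nat} {X : 'I_d -> ptopologicalType}.
Context {k : forall j, X j -> X j -> R} (H : rkhs (tensor_kernel k)).
Variables (K : 'I_d -> R) (alpha eps delta : R) (n B : nat).
Notation kappa := (2 * sensitivity K n * (privacy eps delta)^-1).

(** Chernoff's bound, pointwise. Under the separation hypothesis, an index whose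
    noisy statistic reaches that of the data has a large statistic or a large
    noise, and either doubles the product. A p-value above [alpha] requires
    [alpha * (B + 1) - 1] such indices, which the exponential compensates.
    Doubling, rather than another base, makes each factor affine in an indicator,
    hence easy to average. *)
Lemma one_minus_test_le (pi : {ffun 'I_B -> {ffun 'I_d -> 'S_n}})
    (x : 'I_n -> obs X) (zeta : 'I_B.+1 -> R) (tau s : R) :
  (forall (p : {ffun 'I_d -> 'S_n}) i, dHSIC_sample H (permute_sample p x) < tau ->
     `|zeta i| < s ->
     dHSIC_sample H (permute_sample p x) + kappa * zeta i <
     dHSIC_sample H x + kappa * zeta ord0) ->
  1 - dpdHSIC_test H K alpha eps delta pi x zeta <=
  expR (- (ln 2 * (alpha * B.+1%:R - 1))) *
  (\prod_b (1 + (tau <= dHSIC_sample H (permute_sample (pi b) x))%R%:R)) *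
  \prod_i (1 + (s <= `|zeta i|)%R%:R).
Proof.
move=> sep; set W := \prod_b _; set Z := \prod_i _.
have weight_ge1 (b : bool) : 1 <= 1 + b%:R :> R by rewrite lerDl.
have W0 : 0 <= W by apply: prodr_ge0 => b _; rewrite (le_trans ler01).
have Z0 : 0 <= Z by apply: prodr_ge0 => b _; rewrite (le_trans ler01).
rewrite /dpdHSIC_test; have [_|palpha] := leP (dp_pvalue _ _ _ _ _ _ _) alpha.
  by rewrite subrr !mulr_ge0// expR_ge0.
rewrite subr0 -mulrA expRN ler_pdivlMl ?expR_gt0// mulr1.
pose N : R := \sum_(b < B) (dpM H K eps delta pi x zeta ord0 <=
  dpM H K eps delta pi x zeta (lift ord0 b))%R%:R.
have {}palpha : alpha * B.+1%:R - 1 <= N.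
  move: palpha; rewrite /dp_pvalue (_ : \sum_(i < B.+1 | i != ord0) _ = N); last first.
    by rewrite big_mkcond big_ord_recl /= add0r.
  rewrite ltr_pdivlMl ?ltr0n// mulrC; lra.
have double (b : bool) : expR (ln 2 * b%:R) = 1 + b%:R :> R.
  case: b; last by rewrite mulr0 expR0 addr0.
  by rewrite mulr1 lnK// posrE.
have bound1 (b b' : bool) : 1 + b%:R <= (1 + 1) * (1 + b'%:R) :> R.
  by case: b; case: b'; rewrite /=; lra.
have bound2 (b : bool) : 1 + b%:R <= (1 + 0) * (1 + 1) :> R.
  by case: b; rewrite /=; lra.
have ln2_ge0 : 0 <= ln 2 :> R by rewrite ln_ge0// ler1n.
apply: (@le_trans _ _ (expR (ln 2 * N))).
  by rewrite ler_expR ler_wpM2l.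
have -> : expR (ln 2 * N) = \prod_(b < B) (1 + (dpM H K eps delta pi x zeta ord0 <=
  dpM H K eps delta pi x zeta (lift ord0 b))%R%:R).
  by rewrite mulr_sumr expR_sum; apply: eq_bigr => b _; exact: double.
apply: (@le_trans _ _ (W * \prod_(b < B) (1 + (s <= `|zeta (lift ord0 b)|)%R%:R))).
  rewrite -big_split /=; apply: ler_prod => b _; rewrite (le_trans ler01)//=.
  have [tau_le|h_lt] := leP tau (dHSIC_sample H (permute_sample (pi b) x)).
    exact: bound1.
  have [s_le|z_lt] := leP s `|zeta (lift ord0 b)|.
    exact: bound2.
  have := sep (pi b) (lift ord0 b) h_lt z_lt.
  rewrite /dpM /add_identity liftK unlift_none permute_sample1 ltNge => /negbTE ->.
  by rewrite /=; lra.
rewrite ler_wpM2l// /Z big_ord_recl -[leLHS]mul1r ler_wpM2r//.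
by apply: prodr_ge0 => b _; rewrite (le_trans ler01).
Qed.

(** The average over the permutations enters the lower integrals by
    superadditivity, and only its majorant [G] is integrated as a measurable
    function of the sample and the noise. *)
Lemma type2_error_le_mean (P : probability (obs X) R)
    (G : prodspace (fun _ : 'I_n => obs X) * prodspace (fun _ : 'I_B.+1 => R) -> R) :
  bounded_measurable G ->
  (forall w, avg (fun pi : {ffun 'I_B -> {ffun 'I_d -> 'S_n}} =>
     1 - dpdHSIC_test H K alpha eps delta pi w.1 w.2) <= G w) ->
  (type2_error H K alpha eps delta n B P <=
   (\int[(prod_prob (fun _ : 'I_n => P) \x
          prod_prob (fun _ : 'I_B.+1 => laplace_prob))%E]_w G w)%:E)%E.
Proof.
move=> bG GP; rewrite /type2_error.
set Q := (prod_prob _ \x prod_prob _)%E; set c := #|_|.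
have c0 : 0 < c%:R :> R.
  by rewrite ltr0n; apply/card_gt0P; exists [ffun=> [ffun=> 1%g]].
have test_ge0 pi w : 0 <= 1 - dpdHSIC_test H K alpha eps delta pi w.1 w.2 :> R.
  by rewrite subr_ge0 /dpdHSIC_test lern1 leq_b1.
apply: (@le_trans _ _ ((c%:R^-1)%:E * \int[Q]_w (c%:R%:E * (G w)%:E))%E).
  rewrite lee_pmul2l ?lte_fin ?invr_gt0//.
  under eq_bigr do rewrite unlock.
  apply: (le_trans (ge0_lower_integral_sum _ _ _)).
    by move=> pi w; rewrite lee_fin.
  apply: ge0_le_lower_integral => w; first by apply: sume_ge0 => pi _; rewrite lee_fin.
  by rewrite sumEFin -EFinM lee_fin -ler_pdivrMl// GP.
rewrite -(EFin_mean Q bG) integralZl//; last exact: bounded_measurable_integrable.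
by rewrite muleA -EFinM mulVf ?mul1e// gt_eqF.
Qed.

End test_error.

(** * Splitting the type II error *)

Section error_split.
Context {R : realType} {d : nat} {X : 'I_d -> ptopologicalType}.
Context {k : forall j, X j -> X j -> R} (H : rkhs (tensor_kernel k)).
Variables (K : 'I_d -> R) (alpha eps delta : R) (n B : nat).
Notation kappa := (2 * sensitivity K n * (privacy eps delta)^-1).

Local Notation sample := (prodspace (fun _ : 'I_n => obs X)).
Local Notation noise := (prodspace (fun _ : 'I_B.+1 => R)).

(** The three terms account for a small gap of the data, a large noise on the
    statistic of the data, and too many large permuted statistics or noises.
    Outside the first two events, the product of [one_minus_test_le] is averaged
    over the permutations for fixed data and noise, and then over the noise, both
    times as a product of independent factors. *)
Lemma type2_error_split (P : probability (obs X) R) (f : obs X -> R)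
    (M g0 s0 s1 tau q : R) :
  0 <= M -> (forall x : obs X, tensor_kernel k x x <= M ^+ 2) -> (0 < n)%N ->
  unit_ball H f -> bounded_measurable f ->
  0 <= kappa -> tau + kappa * s1 <= g0 - kappa * s0 ->
  (forall x : 'I_n -> obs X, avg (fun p : {ffun 'I_d -> 'S_n} =>
     (tau <= dHSIC_sample H (permute_sample p x))%R%:R) <= q) ->
  (laplace_prob (large_noise s1) <= q%:E)%E ->
  (type2_error H K alpha eps delta n B P <=
   prod_prob (fun _ : 'I_n => P) [set x | (gap f x <= g0)%R] +
   laplace_prob (large_noise s0) +
   (expR (- (ln 2 * (alpha * B.+1%:R - 1)) + 2 * q * B.+1%:R))%:E)%E.
Proof.
move=> M0 kM n0 Hf bf kappa0 sep tauq.
set Pn := prod_prob _; set A : set sample := [set x | _].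
pose Q := prod_prob (fun _ : 'I_B.+1 => @laplace_prob R).
have mA : measurable A := measurable_gap_le bf g0.
have bA : bounded_measurable (\1_A : sample -> R).
  exact: bounded_measurable_indic.
have bZ s : bounded_measurable (\1_(large_noise s) : R -> R).
  apply: bounded_measurable_indic; exact: measurable_large_noise.
have mZ s : \int[laplace_prob]_z \1_(large_noise s) z =
    fine (laplace_prob (large_noise s)) :> R.
  have := mean_indic (@laplace_prob R) (measurable_large_noise s).
  by move=> <-.
have finZ s :
    (fine (@laplace_prob R (large_noise s)))%:E = laplace_prob (large_noise s).
  by rewrite -mZ; exact: mean_indic (measurable_large_noise s).
rewrite -finZ lee_fin => q1.
have q0 : 0 <= q by rewrite (le_trans _ q1)// fine_ge0.
pose e0 : R := expR (- (ln 2 * (alpha * B.+1%:R - 1))).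
pose Z (z : 'I_B.+1 -> R) : R := \prod_i (1 + \1_(large_noise s1) (z i)).
pose C0 := e0 * (1 + q) ^+ B.
have C00 : 0 <= C0 by rewrite mulr_ge0 ?expR_ge0// exprn_ge0// addr_ge0.
have b1Z s i :
    bounded_measurable (fun z : noise => \1_(large_noise s) (z i) : R).
  by apply: (bounded_measurable_comp _ (bZ s)); exact: measurable_pcoord.
have bW : bounded_measurable (fun z : noise => Z z).
  apply: bounded_measurable_prod => i.
  apply: bounded_measurableD; first exact: bounded_measurable_cst.
  exact: b1Z.
pose G (w : sample * noise) : R :=
  \1_A w.1 + (\1_(large_noise s0) (w.2 ord0) + C0 * Z w.2).
have bGA := bounded_measurable_comp (@measurable_fst _ _ sample noise) bA.
have bGZ :=
  bounded_measurable_comp (@measurable_snd _ _ sample noise) (b1Z s0 ord0).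
have bGW := bounded_measurable_comp (@measurable_snd _ _ sample noise) bW.
have bGCW := bounded_measurableZ C0 bGW.
have bG : bounded_measurable G.
  exact: (bounded_measurableD bGA (bounded_measurableD bGZ bGCW)).
have p0 : (0 < #|{: {ffun 'I_d -> 'S_n}}|)%N.
  by apply/card_gt0P; exists [ffun=> 1%g].
have F0 : (0 < #|{: {ffun 'I_B -> {ffun 'I_d -> 'S_n}}}|)%N.
  by rewrite card_ffun expn_gt0 p0.
have Z1 z : 1 <= Z z.
  apply: (@le_trans _ _ (\prod_(i < B.+1) 1)); first by rewrite big1_eq.
  apply: ler_prod => i _.
  by rewrite ler01 indic_large_noise lerDl ler0n.
apply: (le_trans (@type2_error_le_mean _ _ _ _ H K alpha eps delta n B P G bG _)).
  move=> [x z]; rewrite /G /=.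
  have one_minus_le1 pi : 1 - dpdHSIC_test H K alpha eps delta pi x z <= 1 :> R.
    by rewrite lerBlDr lerDl ler0n.
  have avg_le1 : avg (fun pi : {ffun 'I_B -> {ffun 'I_d -> 'S_n}} =>
      1 - dpdHSIC_test H K alpha eps delta pi x z) <= 1.
    by rewrite -[leRHS](avg_cst F0); apply: ler_avg.
  have CZ0 : 0 <= C0 * Z z by rewrite mulr_ge0// (le_trans ler01).
  rewrite indic_large_noise; have [z0|z0] := leP s0 `|z ord0|.
    by apply: (le_trans avg_le1); rewrite addrCA lerDl addr_ge0.
  have [xA|] := boolP (x \in A).
    by apply: (le_trans avg_le1); rewrite indicE xA lerDl add0r.
  rewrite notin_setE /A /= => /negP; rewrite -ltNge => gx.
  rewrite add0r (@le_trans _ _ (C0 * Z z))//; last by rewrite lerDr.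
  apply: (@le_trans _ _ (avg (fun pi : {ffun 'I_B -> {ffun 'I_d -> 'S_n}} =>
      (e0 * Z z) *
      \prod_b (1 + (tau <= dHSIC_sample H (permute_sample (pi b) x))%R%:R)))).
    apply: ler_avg => pi.
    rewrite (le_trans (@one_minus_test_le _ _ _ _ H _ _ _ _ _ _ _ x z tau s1 _))//.
      move=> p i hp zi.
      have := gap_le_dHSIC_sample M0 kM n0 x Hf.
      have : kappa * z i <= kappa * s1.
        by rewrite ler_wpM2l// (le_trans (ler_norm _))// ltW.
      have : kappa * - s0 <= kappa * z ord0.
        by rewrite ler_wpM2l// lerNl (le_trans (ler_norm _))// normrN ltW.
      by rewrite mulrN; lra.
    rewrite mulrAC /Z (eq_bigr (fun i => 1 + \1_(large_noise s1) (z i))) => [//|i _].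
    by rewrite indic_large_noise.
  rewrite avgZ /C0 [leRHS]mulrAC ler_wpM2l//.
    by rewrite mulr_ge0 ?expR_ge0// (le_trans ler01).
  rewrite (avg_prod (fun b (p : {ffun 'I_d -> 'S_n}) =>
    1 + (tau <= dHSIC_sample H (permute_sample p x))%R%:R)) prodr_const card_ord.
  rewrite lerXn2r ?nnegrE ?addr_ge0//; first by apply: avg_ge0 => p; rewrite addr_ge0.
  by rewrite avgD (avg_cst p0) lerD2l; exact: tauq.
rewrite [X in X%:E](_ : _ = fine (Pn A) + (fine (laplace_prob (large_noise s0)) +
  C0 * (1 + fine (laplace_prob (large_noise s1))) ^+ B.+1)); last first.
  rewrite (meanD _ bGA (bounded_measurableD bGZ bGCW)) (meanD _ bGZ bGCW).
  rewrite (meanZ _ _ bGW) (mean_fst _ _ bA) (mean_snd _ _ (b1Z s0 ord0)).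
  rewrite (mean_snd _ _ bW).
  rewrite (mean_pcoord _ ord0 (bZ s0)) mZ.
  congr (_ + (_ + C0 * _)).
    by have := mean_indic Pn mA => <-.
  pose F (_ : 'I_B.+1) z : R := 1 + \1_(large_noise s1) z.
  have bF i : bounded_measurable (F i).
    by apply: bounded_measurableD => //; exact: bounded_measurable_cst.
  transitivity (\int[Q]_z \prod_(i <- enum 'I_B.+1) F i (z i)).
    by apply: eq_Rintegral => z _; rewrite /Z big_enum.
  rewrite (mean_prod_redraw_all _ (enum_uniq _) bF) big_enum /=.
  rewrite (eq_bigr (fun=> 1 + fine (laplace_prob (large_noise s1)))).
    by rewrite prodr_const card_ord.
  move=> i _; rewrite meanD ?mean_cst ?mZ//; exact: bounded_measurable_cst.
have finA : (fine (Pn A))%:E = Pn A.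
  by have := mean_indic Pn mA => <-.
rewrite -[in leRHS]finA -[in leRHS](finZ s0) -!EFinD lee_fin -addrA !lerD2l.
rewrite /C0 -mulrA expRD ler_wpM2l ?expR_ge0//.
have powq (a : R) m : 0 <= a -> a <= q -> (1 + a) ^+ m <= expR (q * m%:R).
  move=> a0 aq; rewrite expRM_natr lerXn2r ?nnegrE ?expR_ge0 ?addr_ge0//.
  by rewrite (le_trans (expR_ge1Dx a))// ler_expR.
rewrite (_ : 2 * q * B.+1%:R = q * B.+1%:R + q * B.+1%:R); last ring.
have Z1_ge0 : 0 <= fine (laplace_prob (large_noise s1)) by rewrite fine_ge0.
rewrite expRD ler_pM ?exprn_ge0 ?addr_ge0 ?powq//.
by rewrite (le_trans (powq q B q0 _))// ler_expR ler_wpM2l// ler_nat.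
Qed.

End error_split.

(** * Numerical bounds *)

Section constants.
Context {R : realType}.
Implicit Types alpha beta L : R.

(** Expressing every probability through powers of [expR (- L)] lets the factor
    1/2, which holds as [alpha] and [beta] cannot both exceed it, absorb
    numerical constants. *)
Lemma expRN_maxln_le alpha beta L : 0 < alpha < 1 -> 0 < beta < 1 - alpha ->
  L = Num.max (ln (1 / alpha)) (ln (1 / beta)) ->
  [/\ expR (- L) <= alpha, expR (- L) <= beta & expR (- L) <= 1 / 2].
Proof.
move=> /andP[a0 a1] /andP[b0 b1] ->.
have le z : 0 < z -> ln (1 / z) <= Num.max (ln (1 / alpha)) (ln (1 / beta)) ->
    expR (- Num.max (ln (1 / alpha)) (ln (1 / beta))) <= z.
  move=> z0 zL; rewrite -[leRHS](lnK z0) ler_expR lerNl.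
  by rewrite -lnV// -div1r.
have ua : expR (- Num.max (ln (1 / alpha)) (ln (1 / beta))) <= alpha.
  by apply: le => //; rewrite le_max lexx.
have ub : expR (- Num.max (ln (1 / alpha)) (ln (1 / beta))) <= beta.
  by apply: le => //; rewrite le_max lexx orbT.
by split => //; lra.
Qed.

Lemma ln2_ge : 1 / 2 <= ln 2 :> R.
Proof.
rewrite -(expRK (1 / 2)) ler_ln ?posrE ?expR_gt0//.
have := expR_ge1Dx (- (1 / 2) : R); rewrite expRN => h.
have e0 : 0 < expR (1 / 2) :> R by exact: expR_gt0.
have : (1 + - (1 / 2)) * expR (1 / 2) <= 1 :> R by rewrite -ler_pdivlMr// [leRHS]div1r.
by lra.
Qed.

(** With [y] standing for [alpha * (B + 1)], the exponent is
    [ln 2 - (ln 2 - 1 / 16) * y]. As [ln 2 >= 1 / 2] and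
    [y >= 6 * ln (2 / beta) >= 6 * ln 2], it is at most [- y / 6]. *)
Lemma count_tail_le alpha beta (B : nat) : 0 < alpha -> 0 < beta < 1 ->
  6 * alpha^-1 * ln (2 * beta^-1) <= B%:R ->
  expR (- (ln 2 * (alpha * B.+1%:R - 1)) + 2 * (alpha / 32) * B.+1%:R) <=
  beta / 2.
Proof.
move=> a0 /andP[b0 b1] hB; set y := alpha * B.+1%:R.
have y6 : 6 * ln (2 * beta^-1) <= y.
  have : 6 * ln (2 * beta^-1) <= alpha * B%:R.
    rewrite -ler_pdivrMl//; apply: le_trans hB.
    by rewrite mulrA [alpha^-1 * 6]mulrC.
  by rewrite /y -natr1; lra.
have l2 : ln 2 <= ln (2 * beta^-1) :> R.
  by rewrite ler_ln ?posrE ?mulr_gt0 ?invr_gt0// ler_pMr// invf_ge1// ltW.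
have -> : beta / 2 = expR (- ln (2 * beta^-1)).
  by rewrite expRN lnK ?posrE ?mulr_gt0 ?invr_gt0// invfM invrK mulrC.
rewrite ler_expR; have := ln2_ge.
rewrite (_ : 2 * (alpha / 32) * B.+1%:R = y / 16); last by rewrite /y; field.
move: y6 l2; move: (ln 2) (ln _) y => c l y; nra.
Qed.

End constants.

(** * Minimum separation of the test *)

Section hypotheses.
Context {R : realType}.

Lemma psd_kernel_le (X : Type) (k : X -> X -> R) y z : psd_kernel k ->
  k y z + k z y <= k y y + k z z.
Proof.
move=> [_ /(_ 2 (fun i => if i == ord0 then y else z)
                (fun i => if i == ord0 then 1 else -1))].
by rewrite !big_ord_recl !big_ord0 /=; lra.
Qed.

Lemma tensor_kernel_diag_le (d : nat) (K : 'I_d -> R)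
    (X : 'I_d -> ptopologicalType) (k : forall j, X j -> X j -> R) (x : obs X) :
  (forall j y z, 0 <= k j y z <= K j) ->
  tensor_kernel k x x <= (1 + Num.sqrt (\prod_j K j)) ^+ 2.
Proof.
move=> kK; have K0 : 0 <= \prod_j K j.
  by apply: prodr_ge0 => j _; have /andP[] := kK j (x j) (x j); exact: le_trans.
rewrite (@le_trans _ _ (\prod_j K j))//; first exact: ler_prod.
rewrite -[leLHS]sqr_sqrtr// lerXn2r ?nnegrE ?addr_ge0 ?sqrtr_ge0//.
by rewrite lerDr.
Qed.

(** Halving [rho] leaves room for a supremum that is not attained. *)
Lemma dHSIC_witness (d : nat) (X : 'I_d -> ptopologicalType)
    (k : forall j, X j -> X j -> R) (H : rkhs (tensor_kernel k)) (M : R)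
    (P : probability (obs X) R) (rho : R) :
  0 <= M -> (forall x, tensor_kernel k x x <= M ^+ 2) ->
  (forall j, continuous_kernel (k j)) ->
  0 < rho -> (rho%:E <= dHSIC H P)%E ->
  exists f, [/\ unit_ball H f, bounded_measurable f &
    rho / 2 < \int[P]_y f y - \int[prod_prob (marginal P)]_y f y].
Proof.
move=> M0 kM kc rho0 hP.
have : ((rho / 2)%:E < dHSIC H P)%E by apply: lt_le_trans hP; rewrite lte_fin; lra.
move=> /ereal_sup_gt[_ [f Hf <-]] lt; exists f.
have bf : bounded_measurable f := unit_ball_bounded_measurable M0 kM kc Hf.
split => //; move: lt.
by rewrite !unlock !(EFin_mean _ bf) -EFinB lte_fin.
Qed.

End hypotheses.

Theorem theorem4p1 (R : realType) (d : nat) (hd : (2 <= d)%N) (K : 'I_d -> R) :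
  exists2 C : R, 0 < C &
  forall (X : 'I_d -> ptopologicalType) (k : forall j, X j -> X j -> R)
    (H : rkhs (tensor_kernel k)),
  (forall j, separable_space (X j)) ->
  (forall j, continuous_kernel (k j)) ->
  (forall j, bounded_kernel (k j)) ->
  (forall j, psd_kernel (k j)) ->
  characteristic_kernel (tensor_kernel k) ->
  (forall j x y, 0 <= k j x y <= K j) ->
  forall (alpha beta eps delta : R) (n B : nat),
  0 < alpha < 1 -> 0 < beta < 1 - alpha -> 0 < eps -> 0 <= delta < 1 ->
  (0 < n)%N ->
  6 * alpha^-1 * ln (2 * beta^-1) <= B%:R ->
  let L := Num.max (ln (1 / alpha)) (ln (1 / beta)) in
  (min_separation H K alpha eps delta n B beta <=
   (C * Num.max (Num.sqrt (L / n%:R))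
                (L / (n%:R * privacy eps delta)))%:E)%E.
Proof.
set M : R := 1 + Num.sqrt (\prod_j K j); set D : R := d%:R.
have M1 : 1 <= M by rewrite lerDl sqrtr_ge0.
have M0 : 0 <= M by lra.
have D0 : 0 < D by rewrite ltr0n ltnW.
have D2 : 2 <= D by rewrite (ler_nat R 2 d).
have M_gt0 : 0 < M by exact: lt_le_trans M1.
have C0 : 0 < 256 * D ^+ 2 * M.
  by apply: mulr_gt0 M_gt0; apply: mulr_gt0; [rewrite ltr0n|rewrite exprn_gt0].
exists (256 * D ^+ 2 * M) => //.
move=> X k H _ kc _ kpsd _ kK alpha beta eps delta n B alpha01 beta01 eps0
  /andP[delta0 delta1] n0 hB.
cbv zeta; set L := Num.max (ln (1 / alpha)) (ln (1 / beta)).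
have [ua ub u2] := expRN_maxln_le alpha01 beta01 erefl; rewrite -/L in ua ub u2.
set u := expR (- L) in ua ub u2.
have /andP[alpha0 alpha1] := alpha01; have /andP[beta0 beta1] := beta01.
have u0 : 0 < u by exact: expR_gt0.
have L2 : 1 / 2 <= L by have := expR_ge1Dx (- L); rewrite -/u; lra.
have L0 : 0 < L by exact: lt_le_trans L2.
have kM x : tensor_kernel k x x <= M ^+ 2 by exact: tensor_kernel_diag_le.
have N0 : 0 < n%:R :> R by rewrite ltr0n.
set xi := privacy eps delta.
have xi0 : 0 < xi.
  rewrite /xi /privacy ltr_pwDl// ln_ge0// div1r invf_ge1; lra.
set a := Num.sqrt (L / n%:R); set r := Num.max a _.
have Ln0 : 0 < L / n%:R by rewrite divr_gt0.
have a0 : 0 < a by rewrite sqrtr_gt0.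
have a2 : n%:R * a ^+ 2 = L.
  by rewrite sqr_sqrtr ?ltW// mulrC divfK// gt_eqF.
have ar : a <= r by rewrite le_max lexx.
have r0 : 0 < r by exact: lt_le_trans ar.
have invn0 : 0 < n%:R^-1 :> R by rewrite invr_gt0.
have sqrtn0 : 0 <= (Num.sqrt n%:R)^-1 :> R by rewrite invr_ge0 sqrtr_ge0.
have sqrtn2 : (Num.sqrt n%:R)^-1 ^+ 2 = n%:R^-1 :> R.
  by rewrite exprVn sqr_sqrtr ?ler0n.
have sqrtn : (Num.sqrt n%:R)^-1 <= 2 * a.
  rewrite -(ler_pXn2r (n := 2)) ?nnegrE ?mulr_ge0 ?(ltW a0)// sqrtn2 exprMn.
  by rewrite /a sqr_sqrtr ?(ltW Ln0)//; nra.
have invn : n%:R^-1 <= 2 * a.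
  apply: le_trans sqrtn; rewrite -sqrtn2 expr2 ler_piMl//.
  have s1 : 1 <= Num.sqrt n%:R :> R by rewrite -[leLHS]sqrtr1 ler_wsqrtr// ler1n.
  by rewrite invf_le1// (lt_le_trans ltr01).
pose kappa := 2 * sensitivity K n * xi^-1.
have kappa0 : 0 <= kappa.
  by rewrite /kappa /sensitivity !mulr_ge0 ?invr_ge0 ?sqrtr_ge0 ?ler0n// ltW.
have kappaL : kappa * L <= 4 * (M * D * r).
  have br : L / (n%:R * xi) <= r by rewrite le_max lexx orbT.
  have -> : kappa * L = 4 * (Num.sqrt (\prod_j K j) * D * (L / (n%:R * xi))).
    by rewrite /kappa /sensitivity -/D; field; rewrite !gt_eqF.
  rewrite ler_pM2l//; apply: ler_pM => //.
  - by rewrite mulr_ge0 ?sqrtr_ge0// ltW.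
  - by rewrite divr_ge0 ?mulr_ge0 ?ltW.
  - by rewrite ler_wpM2r ?lerDr// ltW.
have powu (m : nat) : u ^+ m = expR (- (m%:R * L)).
  by rewrite -expRM_natr mulNr mulrC.
have uhalf m : u ^+ m <= (1 / 2) ^+ m by rewrite lerXn2r ?nnegrE ?ltW//; lra.
have u3 : u ^+ 3 <= beta / 4.
  have := uhalf 2; have : 0 <= u ^+ 2 by rewrite exprn_ge0// ltW.
  by rewrite exprS; move: (u ^+ 2) u0 ub; clear => v; nra.
have u4 : u ^+ 4 <= beta / 8.
  have := uhalf 3; have : 0 <= u ^+ 3 by rewrite exprn_ge0// ltW.
  by rewrite exprS; move: (u ^+ 3) u0 ub; clear => v; nra.
have u7 : u ^+ 7 <= alpha / 64.
  have := uhalf 6; have : 0 <= u ^+ 6 by rewrite exprn_ge0// ltW.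
  by rewrite exprS; move: (u ^+ 6) u0 ua; clear => v; nra.
apply: ereal_inf_lbound; exists (256 * D ^+ 2 * M * r); last by []. split.
  exact: mulr_gt0 C0 r0.
rewrite /worst_type2_error ge_max lee_fin (ltW beta0) /=.
apply: ge_ereal_sup => _ [P hP <-].
have [|f [Hf bf witness]] := dHSIC_witness M0 kM kc _ hP.
  exact: mulr_gt0 C0 r0.
have fM y := unit_ball_le M0 kM y Hf.
pose m := \int[prod_prob (fun _ : 'I_n => P)]_x gap f x.
have gapE : _ <= m := @mean_gap_ge R d X n M n0 M0 P f fM bf.
have MDr0 : 0 < M * D * r by rewrite !mulr_gt0.
have mP : 248 * (M * D * r) <= m.
  have : 2 * M * D ^+ 2 / n%:R <= 2 * M * D ^+ 2 * (2 * r).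
    apply: ler_wpM2l; first by rewrite !mulr_ge0 ?sqr_ge0.
    by rewrite (le_trans invn)// ler_pM2l.
  have : 2 * (M * D * r) <= D * (M * D * r) by rewrite ler_pM2r.
  by move: gapE witness; rewrite -/D; clear; lra.
(* this parameter makes every exponent of the two Chernoff bounds a multiple
   of [L] *)
pose lam := L / (M * D * a).
have lam0 : 0 <= lam.
  by rewrite divr_ge0// ?mulr_ge0 ?ltW.
have lamE : lam * (M * D * a) = L.
  by rewrite divfK// gt_eqF// !mulr_gt0.
have lam2E : lam ^+ 2 * M ^+ 2 / n%:R * D ^+ 2 = L.
  transitivity (L ^+ 2 / (n%:R * a ^+ 2)).
    by rewrite /lam; field; rewrite !gt_eqF.
  by rewrite a2 expr2 mulfK// gt_eqF.
have lam2_ge0 : 0 <= lam ^+ 2 * M ^+ 2 / n%:R.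
  exact: divr_ge0 (mulr_ge0 (sqr_ge0 _) (sqr_ge0 _)) (ltW N0).
have lamr : L <= lam * (M * D * r).
  by rewrite -lamE ler_wpM2l// ler_wpM2l// mulr_ge0// ltW.
apply: (le_trans (@type2_error_split R d X k H K alpha eps delta n B P f M
  (m - 21 * (M * D * a)) (8 * L) (14 * L) (72 * (M * D * r)) (alpha / 32)
  M0 kM n0 Hf bf kappa0 _ _ _)).
- have : M * D * a <= M * D * r by rewrite ler_wpM2l// mulr_ge0// ltW.
  (* 72 for the permuted statistic, 4 * (14 + 8) for the two noises and 21 for
     the deviation of the gap add up to 181 *)
  by move: mP kappaL MDr0; rewrite -/xi -/kappa; clear; lra.
- move=> x.
  apply: (le_trans (@dHSIC_permute_tail R d X k H n M n0 M0 kM _ _ x lam _ lam0)).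
  + by move=> j y z; have /andP[] := kK j y z.
  + by move=> j y z; exact: psd_kernel_le.
  apply: (@le_trans _ _ (u ^+ 7)); last by move: u7 alpha0; clear; lra.
  rewrite powu ler_expR -/D.
  have mean_term : lam * (M / Num.sqrt n%:R) <= L.
    apply: (@le_trans _ _ (2 * (lam * (M * a)))).
      rewrite (_ : 2 * (lam * (M * a)) = lam * (M * (2 * a))); last by ring.
      by rewrite ler_wpM2l// ler_wpM2l.
    have : 2 * (lam * (M * a)) <= D * (lam * (M * a)).
      apply: ler_wpM2r => //.
      exact: mulr_ge0 lam0 (mulr_ge0 M0 (ltW a0)).
    by move: lamE; clear; lra.
  have variance_term : 128 * D * lam ^+ 2 * M ^+ 2 / n%:R <= 64 * L.
    rewrite -[in leRHS]lam2E; set z := _ / _ in lam2_ge0 *.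
    rewrite (_ : 128 * D * lam ^+ 2 * M ^+ 2 / n%:R = 64 * (z * (2 * D))); last first.
      by rewrite /z; ring.
    by rewrite ler_pM2l// ler_wpM2l// expr2 ler_pM2r.
  by move: lamr mean_term variance_term; clear; lra.
- apply: (le_trans (laplace_prob_tail _)); rewrite lee_fin.
  rewrite (_ : 14 * L / 2 = 7%:R * L) -?powu; last by field.
  by move: u7 alpha0; clear; lra.
have beta01' : 0 < beta < 1 by move: alpha0 beta0 beta1; clear; lra.
have countE := count_tail_le alpha0 beta01' hB.
have tail1 := @gap_lower_tail R d X n M n0 M0 P f fM bf lam (21 * (M * D * a)) lam0.
have tail2 := @laplace_prob_tail R (8 * L).
rewrite -lee_fin in countE.
apply: (le_trans (leeD (leeD tail1 tail2) countE)).
rewrite -!EFinD lee_fin (_ : 8 * L / 2 = 4%:R * L) -?powu; last by field.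
have : expR (- (lam * (21 * (M * D * a))) +
    8 * d.+1%:R ^+ 2 * lam ^+ 2 * M ^+ 2 / n%:R) <= u ^+ 3.
  rewrite powu ler_expR -natr1 -/D.
  have : 8 * (D + 1) ^+ 2 * lam ^+ 2 * M ^+ 2 / n%:R <= 18 * L.
    rewrite -[in leRHS]lam2E; set z := _ / _ in lam2_ge0 *.
    rewrite (_ : 8 * (D + 1) ^+ 2 * lam ^+ 2 * M ^+ 2 / n%:R =
                 z * (8 * (D + 1) ^+ 2)); last by rewrite /z; ring.
    by rewrite [leRHS]mulrCA ler_wpM2l//; move: D2; clear; nra.
  by rewrite (mulrCA lam) lamE; clear; lra.
by move: u3 u4; clear; lra.
Qed.
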